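(* Precomposition with the desuspension functor and with the reduced suspension functor define an equivalence of categories between $\mathrm{Mod}(\mathrm{Syn}(\mathsf{MCaTT}))$ and the full subcategory of $\mathrm{Mod}(\mathrm{Syn}(\mathsf{CaTT}))$ on those models $F$ with $F(D^0)$ a singleton.
   Context: $\mathsf{CaTT}$ is the Finster–Mimram type theory for weak $\omega$-categories (types $\star$, $\mathrm{Hom}_Atu$; term constructors $\mathsf{op}$, $\mathsf{coh}$ indexed by ps-contexts). $\mathsf{MCaTT}$ is the type theory with a unit type $\mathbb{1}$ (constant $()$, $\eta$-rule identifying all terms of type $\mathbb{1}$ with $()$), types $\mathrm{Hom}_Atu$ ($\star$ abbreviating $\mathrm{Hom}_{\mathbb{1}}()()$), and term constructors $\mathsf{mop}_{\Gamma,A}[\gamma]$, $\mathsf{mcoh}_{\Gamma,A}[\gamma]$ for $\Gamma$ a ps-context and $A$ a valid operation/coherence type in $\mathsf{CaTT}$, with $\gamma$ a substitution into the desuspension of $\Gamma$. $\mathrm{Syn}(T)$ is the syntactic category with families; a model of a category with families $C$ is a functor $C\to\mathbf{Set}$ preserving the terminal object and pullbacks along display maps, and $\mathrm{Mod}(C)$ denotes the category of models. $D^0=(x:\star)$. The desuspension $\mathrm{D}:\mathrm{Syn}(\mathsf{CaTT})\to\mathrm{Syn}(\mathsf{MCaTT})$ is the morphism of categories with families replacing $\star$ by $\mathbb{1}$, $\mathsf{op}$ by $\mathsf{mop}$, $\mathsf{coh}$ by $\mathsf{mcoh}$; the reduced suspension $\Sigma_r:\mathrm{Syn}(\mathsf{MCaTT})\to\mathrm{Syn}(\mathsf{CaTT})$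 adds a fresh variable $\bullet:\star$, sends $\mathbb{1}$ to $\star$, $()$ to $\bullet$, $\star$ to $\mathrm{Hom}_\star\bullet\bullet$, drops variables of type $\mathbb{1}$, and sends $\mathsf{mop}_{\Theta,A}[\gamma]$ to $\mathsf{op}_{\Theta,A}[\bullet_\Theta\circ\Sigma_r\gamma]$ (similarly for $\mathsf{mcoh}$), where $\bullet_\Theta:\Sigma_r(\mathrm{D}\Theta)\to\Theta$ maps variables of type $\star$ to $\bullet$ and other variables to themselves. The functors of the equivalence are $F\mapsto F\circ\mathrm{D}$ and $F\mapsto F\circ\Sigma_r$. *)

(* Defs.v *)
From Stdlib Require Import Arith List Lia RelationClasses.
Import ListNotations.

Set Implicit Arguments.
Unset Strict Implicit.
Unset Printing Implicit Defensive.

(** Hom-sets are setoids: [hom_eq] plays the role of equality of morphisms.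
    This is what makes it possible to use substitutions up to definitional
    equality as morphisms without forming quotients. *)

Record Category := {
  Ob :> Type;
  Hom : Ob -> Ob -> Type;
  hom_eq : forall a b, Hom a b -> Hom a b -> Prop;
  hom_equiv : forall a b, Equivalence (@hom_eq a b);
  idm : forall a, Hom a a;
  comp : forall a b c, Hom b c -> Hom a b -> Hom a c;
  comp_ext : forall a b c (g g' : Hom b c) (f f' : Hom a b),
    hom_eq g g' -> hom_eq f f' -> hom_eq (comp g f) (comp g' f');
  comp_idl : forall a b (f : Hom a b), hom_eq (comp (idm b) f) f;
  comp_idr : forall a b (f : Hom a b), hom_eq (comp f (idm a)) f;
  comp_assoc : forall a b c d (h : Hom c d) (g : Hom b c) (f : Hom a b),
    hom_eq (comp h (comp g f)) (comp (comp h g) f)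
}.

Arguments Hom {c0} _ _ : rename.
Arguments hom_eq {c0} [a b] _ _ : rename.
Arguments idm {c0} a : rename.
Arguments comp {c0} [a b c] _ _ : rename.

Declare Scope cat_scope.
Infix "∘" := comp (at level 40, left associativity) : cat_scope.
Infix "≈" := hom_eq (at level 70, no associativity) : cat_scope.
Open Scope cat_scope.

#[export] Existing Instance hom_equiv.

Definition is_terminal (C : Category) (t : C) : Prop :=
  forall x : C, exists f : Hom x t, forall g : Hom x t, g ≈ f.

(** The square
<<
      p --q--> b
      |u       |g
      a --f--> c
>> *)
Definition is_pullback (C : Category) (p a b c : C)
    (u : Hom p a) (q : Hom p b) (f : Hom a c) (g : Hom b c) : Prop :=
  f ∘ u ≈ g ∘ q /\
  forall (x : C) (h : Hom x a) (k : Hom x b), f ∘ h ≈ g ∘ k ->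
    exists m : Hom x p, (u ∘ m ≈ h /\ q ∘ m ≈ k) /\
      forall m' : Hom x p, u ∘ m' ≈ h -> q ∘ m' ≈ k -> m' ≈ m.

Definition isomorphic (C : Category) (a b : C) : Prop :=
  exists (f : Hom a b) (g : Hom b a), g ∘ f ≈ idm a /\ f ∘ g ≈ idm b.

Record Functor (C D : Category) := {
  fob :> C -> D;
  fmap : forall a b : C, Hom a b -> Hom (fob a) (fob b);
  fmap_ext : forall (a b : C) (f g : Hom a b), f ≈ g -> fmap f ≈ fmap g;
  fmap_id : forall a : C, fmap (idm a) ≈ idm (fob a);
  fmap_comp : forall (a b c : C) (g : Hom b c) (f : Hom a b),
    fmap (g ∘ f) ≈ fmap g ∘ fmap f
}.

Arguments fmap [C D] _ [a b] _.

Record NatTrans (C D : Category) (F G : Functor C D) := {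
  nt_app :> forall a : C, Hom (F a) (G a);
  nt_nat : forall (a b : C) (f : Hom a b),
    nt_app b ∘ fmap F f ≈ fmap G f ∘ nt_app a
}.

Definition FunId (C : Category) : Functor C C.
Proof.
  refine {| fob := fun a => a; fmap := fun a b f => f |}.
  - auto.
  - intros; reflexivity.
  - intros; reflexivity.
Defined.

Definition FunComp (C D E : Category) (G : Functor D E) (F : Functor C D) :
  Functor C E.
Proof.
  refine {| fob := fun a => G (F a); fmap := fun a b f => fmap G (fmap F f) |}.
  - intros; now apply fmap_ext, fmap_ext.
  - intros a. transitivity (fmap G (idm (F a))); [apply fmap_ext|]; apply fmap_id.
  - intros. etransitivity; [apply fmap_ext|]; apply fmap_comp.
Defined.

Definition nt_id (C D : Category) (F : Functor C D) : NatTrans F F.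
Proof.
  refine {| nt_app := fun a => idm (F a) |}.
  intros. etransitivity; [apply comp_idl|symmetry; apply comp_idr].
Defined.

Definition nt_comp (C D : Category) (F G H : Functor C D)
  (s : NatTrans G H) (r : NatTrans F G) : NatTrans F H.
Proof.
  refine {| nt_app := fun a => s a ∘ r a |}.
  intros.
  etransitivity; [symmetry; apply comp_assoc|].
  etransitivity; [apply comp_ext; [reflexivity|apply nt_nat]|].
  etransitivity; [apply comp_assoc|].
  etransitivity; [apply comp_ext; [apply nt_nat|reflexivity]|].
  symmetry; apply comp_assoc.
Defined.

Definition FunCat (C D : Category) : Category.
Proof.
  refine {| Ob := Functor C D; Hom := fun F G => NatTrans F G;
            hom_eq := fun F G r s => forall a : C, r a ≈ s a;
            idm := fun F => nt_id F;
            comp := fun F G H s r => nt_comp s r |}.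
  - intros F G; split.
    + intros r a; reflexivity.
    + intros r s H a; symmetry; apply H.
    + intros r s t H K a; etransitivity; [apply H|apply K].
  - intros; simpl; now apply comp_ext.
  - intros; simpl; apply comp_idl.
  - intros; simpl; apply comp_idr.
  - intros; simpl; apply comp_assoc.
Defined.

Definition SET : Category.
Proof.
  refine {| Ob := Type; Hom := fun A B => A -> B;
            hom_eq := fun A B f g => forall x, f x = g x;
            idm := fun A x => x;
            comp := fun A B C g f x => g (f x) |}.
  - intros A B; split.
    + intros f x; reflexivity.
    + intros f g H x; symmetry; apply H.
    + intros f g h H K x; transitivity (g x); [apply H|apply K].
  - intros A B C g g' f f' H K x; now rewrite H, K.
  - easy.
  - easy.
  - easy.
Defined.

Definition FullSub (C : Category) (P : C -> Prop) : Category.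
Proof.
  refine {| Ob := {x : C | P x};
            Hom := fun x y => Hom (proj1_sig x) (proj1_sig y);
            hom_eq := fun x y f g => f ≈ g;
            idm := fun x => idm (proj1_sig x);
            comp := fun x y z g f => g ∘ f |}.
  - intros x y z; apply (@comp_ext C).
  - intros x y; apply (@comp_idl C).
  - intros x y; apply (@comp_idr C).
  - intros x y z w; apply (@comp_assoc C).
Defined.

Definition incl_full (C : Category) (P : C -> Prop) : Functor (FullSub P) C.
Proof.
  refine (@Build_Functor (FullSub P) C (fun x => proj1_sig x) (fun a b f => f) _ _ _).
  - auto.
  - intros a; apply (@hom_equiv C).
  - intros; apply (@hom_equiv C).
Defined.

Definition lift_full (C D : Category) (P : D -> Prop) (F : Functor C D)
  (h : forall x : C, P (F x)) : Functor C (FullSub P).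
Proof.
  refine (@Build_Functor C (FullSub P) (fun x => exist P (F x) (h x))
            (fun a b f => fmap F f) _ _ _).
  - intros; now apply (@fmap_ext C D).
  - intros; apply (fmap_id F).
  - intros; apply (fmap_comp F).
Defined.

Definition precomp (C D E : Category) (K : Functor C D) :
  Functor (FunCat D E) (FunCat C E).
Proof.
  refine (@Build_Functor (FunCat D E) (FunCat C E)
    (fun F => FunComp F K)
    (fun F G r => {| nt_app := fun a => r (K a) : Hom (FunComp F K a) (FunComp G K a);
                     nt_nat := fun a b f => nt_nat r (fmap K f) |}) _ _ _).
  - intros F G r s H a; apply H.
  - intros F a; simpl; reflexivity.
  - intros F G H s r a; simpl; reflexivity.
Defined.

Definition inverse_equivalences (C D : Category)
    (F : Functor C D) (G : Functor D C) : Prop :=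
  isomorphic (C := FunCat C C) (FunComp G F) (FunId C) /\
  isomorphic (C := FunCat D D) (FunComp F G) (FunId D).

(** The functor to families of sets is given by the presheaves [Ty] and [Tm]
    together with the map [ty_of] whose fibre over a type is its set of terms. *)

Record CwF := {
  base :> Category;
  empty_ctx : base;
  empty_terminal : is_terminal empty_ctx;
  Ty : base -> Type;
  ty_eq : forall G, Ty G -> Ty G -> Prop;
  ty_equiv : forall G, Equivalence (@ty_eq G);
  ty_act : forall D G : base, Hom D G -> Ty G -> Ty D;
  ty_act_ext : forall (D G : base) (g g' : Hom D G) (A A' : Ty G),
    g ≈ g' -> ty_eq A A' -> ty_eq (ty_act g A) (ty_act g' A');
  ty_act_id : forall (G : base) (A : Ty G), ty_eq (ty_act (idm G) A) A;
  ty_act_comp : forall (E D G : base) (g : Hom D G) (h : Hom E D) (A : Ty G),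
    ty_eq (ty_act (g ∘ h) A) (ty_act h (ty_act g A));
  Tm : base -> Type;
  tm_eq : forall G, Tm G -> Tm G -> Prop;
  tm_equiv : forall G, Equivalence (@tm_eq G);
  tm_act : forall D G : base, Hom D G -> Tm G -> Tm D;
  tm_act_ext : forall (D G : base) (g g' : Hom D G) (t t' : Tm G),
    g ≈ g' -> tm_eq t t' -> tm_eq (tm_act g t) (tm_act g' t');
  tm_act_id : forall (G : base) (t : Tm G), tm_eq (tm_act (idm G) t) t;
  tm_act_comp : forall (E D G : base) (g : Hom D G) (h : Hom E D) (t : Tm G),
    tm_eq (tm_act (g ∘ h) t) (tm_act h (tm_act g t));
  ty_of : forall G, Tm G -> Ty G;
  ty_of_ext : forall (G : base) (t t' : Tm G),
    tm_eq t t' -> ty_eq (ty_of t) (ty_of t');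
  ty_of_act : forall (D G : base) (g : Hom D G) (t : Tm G),
    ty_eq (ty_of (tm_act g t)) (ty_act g (ty_of t));
  ext : forall G : base, Ty G -> base;
  disp : forall (G : base) (A : Ty G), Hom (ext A) G;
  gen : forall (G : base) (A : Ty G), Tm (ext A);
  ty_of_gen : forall (G : base) (A : Ty G),
    ty_eq (ty_of (gen A)) (ty_act (disp A) A);
  ext_univ : forall (D G : base) (A : Ty G) (g : Hom D G) (t : Tm D),
    ty_eq (ty_of t) (ty_act g A) ->
    exists m : Hom D (ext A),
      (disp A ∘ m ≈ g /\ tm_eq (tm_act m (gen A)) t) /\
      forall m' : Hom D (ext A),
        disp A ∘ m' ≈ g -> tm_eq (tm_act m' (gen A)) t -> m' ≈ m
}.

Arguments disp [c G] A : rename.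
Arguments ext [c G] A : rename.

(** The display maps of [C] are the maps [disp A]; all their pullback squares are
    required to be preserved, not only the canonical ones. *)
Definition is_model (C : CwF) (F : Functor C SET) : Prop :=
  is_terminal (F (empty_ctx C)) /\
  forall (G D P : C) (A : Ty G) (g : Hom D G) (u : Hom P D) (q : Hom P (ext A)),
    is_pullback u q g (disp A) ->
    is_pullback (fmap F u) (fmap F q) (fmap F g) (fmap F (disp A)).

Definition Mod (C : CwF) : Category := FullSub (C := FunCat C SET) (@is_model C).

Definition is_singleton (X : Type) : Prop := exists x : X, forall y : X, y = x.

(** Variables are natural numbers. [Con Op G A g] and [Con Coh G A g] are
    the terms op_{G,A}[g] and coh_{G,A}[g]; the variables of [G] are bound in
    them.  Substitutions are lists of bindings. *)

Inductive kind : Set := Op | Coh.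

Inductive ty : Set :=
| Star
| Arr (A : ty) (t u : tm)
with tm : Set :=
| Var (x : nat)
| Con (k : kind) (G : ctx) (A : ty) (g : sub)
with ctx : Set :=
| cnil
| cext (G : ctx) (x : nat) (A : ty)
with sub : Set :=
| snil
| sext (g : sub) (x : nat) (t : tm).

Scheme tm_mind := Induction for tm Sort Prop
with sub_mind := Induction for sub Sort Prop.
Combined Scheme tm_sub_mind from tm_mind, sub_mind.

Fixpoint lookup (g : sub) (x : nat) : tm :=
  match g with
  | snil => Var x
  | sext g y t => if x =? y then t else lookup g x
  end.

Fixpoint tm_sub (t : tm) (g : sub) : tm :=
  match t with
  | Var x => lookup g x
  | Con k G A d => Con k G A (sub_comp d g)
  end
with sub_comp (d g : sub) : sub :=
  match d with
  | snil => snil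
  | sext d x t => sext (sub_comp d g) x (tm_sub t g)
  end.

Fixpoint ty_sub (A : ty) (g : sub) : ty :=
  match A with
  | Star => Star
  | Arr A t u => Arr (ty_sub A g) (tm_sub t g) (tm_sub u g)
  end.

Fixpoint sub_id (G : ctx) : sub :=
  match G with
  | cnil => snil
  | cext G x _ => sext (sub_id G) x (Var x)
  end.

Fixpoint tm_vars (t : tm) : list nat :=
  match t with
  | Var x => [x]
  | Con _ _ _ g => sub_vars g
  end
with sub_vars (g : sub) : list nat :=
  match g with
  | snil => []
  | sext g _ t => sub_vars g ++ tm_vars t
  end.

Fixpoint ty_vars (A : ty) : list nat :=
  match A with
  | Star => []
  | Arr A t u => ty_vars A ++ tm_vars t ++ tm_vars u
  end.

Fixpoint dom (G : ctx) : list nat :=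
  match G with
  | cnil => []
  | cext G x _ => x :: dom G
  end.

Fixpoint in_ctx (x : nat) (A : ty) (G : ctx) : Prop :=
  match G with
  | cnil => False
  | cext G y B => (x = y /\ A = B) \/ in_ctx x A G
  end.

(** A variable of type [A] is a cell of dimension [ty_dim A]. *)
Fixpoint ty_dim (A : ty) : nat :=
  match A with
  | Star => 0
  | Arr A _ _ => S (ty_dim A)
  end.

Fixpoint ctx_dim (G : ctx) : nat :=
  match G with
  | cnil => 0
  | cext G _ A => Nat.max (ctx_dim G) (ty_dim A)
  end.

Fixpoint ctx_len (G : ctx) : nat :=
  match G with
  | cnil => 0
  | cext G _ _ => S (ctx_len G)
  end.

(** Since ps-contexts only occur bound in term constructors, their variables
    are required to be 0, 1, 2, ..., which selects one representative in each
    class of ps-contexts up to renaming. *)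
Inductive ps_at : ctx -> nat -> ty -> Prop :=
| ps_at_start : ps_at (cext cnil 0 Star) 0 Star
| ps_at_up G x A : ps_at G x A ->
    let y := ctx_len G in
    let f := S (ctx_len G) in
    ps_at (cext (cext G y A) f (Arr A (Var x) (Var y))) f (Arr A (Var x) (Var y))
| ps_at_down G f A x y : ps_at G f (Arr A (Var x) (Var y)) -> ps_at G y A.

Definition ps (G : ctx) : Prop := exists x, ps_at G x Star.

(** The [i]-dimensional source (resp. target) of a ps-context: variables of
    dimension greater than [i] are removed, and of each string of parallel
    [i]-dimensional variables only the first (resp. last) one is kept. *)
Fixpoint ps_src (i : nat) (G : ctx) : ctx :=
  match G with
  | cext (cext G y A) f B =>
      if i <=? ty_dim A then ps_src i G else cext (cext (ps_src i G) y A) f B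
  | _ => G
  end.

Definition drop (G : ctx) : ctx :=
  match G with
  | cnil => cnil
  | cext G _ _ => G
  end.

Fixpoint ps_tgt (i : nat) (G : ctx) : ctx :=
  match G with
  | cext (cext G y A) f B =>
      if i <? ty_dim A then ps_tgt i G
      else if i =? ty_dim A then cext (drop (ps_tgt i G)) y A
      else cext (cext (ps_tgt i G) y A) f B
  | _ => G
  end.

(** Var(t) ∪ Var(A) = Var(G) *)
Definition full (G : ctx) (t : tm) (A : ty) : Prop :=
  forall x, In x (tm_vars t ++ ty_vars A) <-> In x (dom G).

Inductive wf_ctx : ctx -> Prop :=
| wf_cnil : wf_ctx cnil
| wf_cext G x A : wf_ctx G -> wf_ty G A -> ~ In x (dom G) -> wf_ctx (cext G x A)
with wf_ty : ctx -> ty -> Prop :=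
| wf_Star G : wf_ctx G -> wf_ty G Star
| wf_Arr G A t u : wf_ty G A -> wf_tm G t A -> wf_tm G u A -> wf_ty G (Arr A t u)
with wf_tm : ctx -> tm -> ty -> Prop :=
| wf_Var G x A : wf_ctx G -> in_ctx x A G -> wf_tm G (Var x) A
| wf_Con D k G A g : ps G -> valid k G A -> wf_sub D g G ->
    wf_tm D (Con k G A g) (ty_sub A g)
with wf_sub : ctx -> sub -> ctx -> Prop :=
| wf_snil D : wf_ctx D -> wf_sub D snil cnil
| wf_sext D g t G x A : wf_sub D g G -> wf_ctx (cext G x A) ->
    wf_tm D t (ty_sub A g) -> wf_sub D (sext g x t) (cext G x A)
(** [valid Op G A] and [valid Coh G A]: the type [A] is a valid operation type,
    resp. coherence type, in the ps-context [G].  A ps-context of dimension 0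
    has no boundary and hence no operation type. *)
with valid : kind -> ctx -> ty -> Prop :=
| valid_Op G A t u i : ctx_dim G = S i ->
    wf_tm (ps_src i G) t A -> wf_tm (ps_tgt i G) u A ->
    full (ps_src i G) t A -> full (ps_tgt i G) u A ->
    valid Op G (Arr A t u)
| valid_Coh G A t u : wf_tm G t A -> wf_tm G u A ->
    full G t A -> full G u A -> valid Coh G (Arr A t u).

Scheme wf_ctx_mind := Minimality for wf_ctx Sort Prop
with wf_ty_mind := Minimality for wf_ty Sort Prop
with wf_tm_mind := Minimality for wf_tm Sort Prop
with wf_sub_mind := Minimality for wf_sub Sort Prop
with valid_mind := Minimality for valid Sort Prop.
Combined Scheme wf_mind from wf_ctx_mind, wf_ty_mind, wf_tm_mind, wf_sub_mind, valid_mind.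

Fixpoint sub_dom (g : sub) : list nat :=
  match g with
  | snil => []
  | sext g x _ => x :: sub_dom g
  end.

Lemma tm_sub_sub_gen g h k :
  (forall t, (forall x, In x (tm_vars t) -> tm_sub (lookup g x) h = lookup k x) ->
     tm_sub (tm_sub t g) h = tm_sub t k) /\
  (forall d, (forall x, In x (sub_vars d) -> tm_sub (lookup g x) h = lookup k x) ->
     sub_comp (sub_comp d g) h = sub_comp d k).
Proof.
  apply tm_sub_mind; simpl; auto.
  - intros k0 G A d IH H; now rewrite IH.
  - intros d IHd x t IHt H.
    rewrite IHd, IHt; auto; intros; apply H, in_or_app; auto.
Qed.

Lemma ty_sub_sub_gen g h k A :
  (forall x, In x (ty_vars A) -> tm_sub (lookup g x) h = lookup k x) ->
  ty_sub (ty_sub A g) h = ty_sub A k.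
Proof.
  induction A as [|A IH t u]; simpl; auto; intros H.
  rewrite IH, !(proj1 (tm_sub_sub_gen g h k)); auto;
    intros; apply H; rewrite !in_app_iff; auto.
Qed.

Lemma tm_sub_agree g h :
  (forall t, (forall x, In x (tm_vars t) -> lookup g x = lookup h x) ->
     tm_sub t g = tm_sub t h) /\
  (forall d, (forall x, In x (sub_vars d) -> lookup g x = lookup h x) ->
     sub_comp d g = sub_comp d h).
Proof.
  apply tm_sub_mind; simpl; auto.
  - intros k0 G A d IH H; now rewrite IH.
  - intros d IHd x t IHt H.
    rewrite IHd, IHt; auto; intros; apply H, in_or_app; auto.
Qed.

Lemma ty_sub_agree g h A :
  (forall x, In x (ty_vars A) -> lookup g x = lookup h x) -> ty_sub A g = ty_sub A h.
Proof.
  induction A as [|A IH t u]; simpl; auto; intros H.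
  rewrite IH, !(proj1 (tm_sub_agree g h)); auto;
    intros; apply H; rewrite !in_app_iff; auto.
Qed.

Lemma tm_sub_var g (H : forall x, lookup g x = Var x) :
  (forall t, tm_sub t g = t) /\ (forall d, sub_comp d g = d).
Proof.
  apply tm_sub_mind; simpl; auto.
  - intros k0 G A d IH; now rewrite IH.
  - intros d IHd x t IHt; now rewrite IHd, IHt.
Qed.

Lemma lookup_id G x : lookup (sub_id G) x = Var x.
Proof.
  induction G as [|G IH y A]; simpl; auto.
  destruct (Nat.eqb_spec x y); subst; auto.
Qed.

Lemma tm_sub_id t G : tm_sub t (sub_id G) = t.
Proof. apply tm_sub_var, lookup_id. Qed.

Lemma sub_comp_idr d G : sub_comp d (sub_id G) = d.
Proof. apply tm_sub_var, lookup_id. Qed.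

Lemma ty_sub_id A G : ty_sub A (sub_id G) = A.
Proof. induction A; simpl; rewrite ?tm_sub_id; congruence. Qed.

Lemma lookup_comp g h x :
  In x (sub_dom g) -> lookup (sub_comp g h) x = tm_sub (lookup g x) h.
Proof.
  induction g as [|g IH y t]; simpl; [easy|].
  destruct (Nat.eqb_spec x y); auto.
  intros [->|]; [easy|auto].
Qed.

Lemma tm_sub_sub t g h :
  incl (tm_vars t) (sub_dom g) -> tm_sub (tm_sub t g) h = tm_sub t (sub_comp g h).
Proof. intros H; apply tm_sub_sub_gen; intros; symmetry; apply lookup_comp; auto. Qed.

Lemma sub_comp_assoc d g h :
  incl (sub_vars d) (sub_dom g) ->
  sub_comp (sub_comp d g) h = sub_comp d (sub_comp g h).
Proof. intros H; apply tm_sub_sub_gen; intros; symmetry; apply lookup_comp; auto. Qed.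

Lemma ty_sub_sub A g h :
  incl (ty_vars A) (sub_dom g) -> ty_sub (ty_sub A g) h = ty_sub A (sub_comp g h).
Proof. intros H; apply ty_sub_sub_gen; intros; symmetry; apply lookup_comp; auto. Qed.

Lemma lookup_sext_ne g x t y : x <> y -> lookup (sext g x t) y = lookup g y.
Proof. intros H; simpl; destruct (Nat.eqb_spec y x); congruence. Qed.

Lemma ty_sub_sext A g x t : ~ In x (ty_vars A) -> ty_sub A (sext g x t) = ty_sub A g.
Proof. intros H; apply ty_sub_agree; intros; apply lookup_sext_ne; congruence. Qed.

Lemma sub_comp_sext d g x t :
  ~ In x (sub_vars d) -> sub_comp d (sext g x t) = sub_comp d g.
Proof. intros H; apply tm_sub_agree; intros; apply lookup_sext_ne; congruence. Qed.

Lemma in_ctx_dom x A G : in_ctx x A G -> In x (dom G).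
Proof. induction G; simpl; [easy|]; intuition. Qed.

Definition sub_ctx (G H : ctx) : Prop := forall x A, in_ctx x A G -> in_ctx x A H.

Lemma ps_src_sub i G : sub_ctx (ps_src i G) G.
Proof.
  revert G; fix IH 1; intros [|[|G y A] f B]; simpl; try (intros ? ?; auto; fail).
  intros x C; specialize (IH G x C).
  destruct (i <=? ty_dim A); simpl; intuition.
Qed.

Lemma drop_sub G : sub_ctx (drop G) G.
Proof. destruct G; simpl; intros ? ?; simpl; auto. Qed.

Lemma ps_tgt_sub i G : sub_ctx (ps_tgt i G) G.
Proof.
  revert G; fix IH 1; intros [|[|G y A] f B]; simpl; try (intros ? ?; auto; fail).
  intros x C; specialize (IH G x C).
  destruct (i <? ty_dim A); [|destruct (i =? ty_dim A)]; simpl; intuition.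
  apply drop_sub in H0; auto.
Qed.

Lemma sub_ctx_dom G H : sub_ctx G H -> incl (dom G) (dom H).
Proof.
  intros S x Hx.
  assert (E : exists A, in_ctx x A G).
  { clear S; induction G as [|G IH y A]; simpl in *; [easy|].
    destruct Hx as [->|Hx]; [eauto|]. destruct (IH Hx); eauto. }
  destruct E as [A E]; apply in_ctx_dom with A, S, E.
Qed.

Lemma wf_scoped :
  (forall G, wf_ctx G -> forall x A, in_ctx x A G -> incl (ty_vars A) (dom G)) /\
  (forall G A, wf_ty G A -> incl (ty_vars A) (dom G)) /\
  (forall G t A, wf_tm G t A -> incl (tm_vars t) (dom G)) /\
  (forall D g G, wf_sub D g G -> incl (sub_vars g) (dom D) /\ sub_dom g = dom G) /\
  (forall k G A, valid k G A -> incl (ty_vars A) (dom G)).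
Proof.
  apply wf_mind; simpl; try easy.
  - intros G x A _ IHG _ IHA _ y B [[-> ->]|H]; apply incl_tl; eauto.
  - intros; repeat apply incl_app; auto.
  - intros G x A _ _ H y [<-|[]]; eapply in_ctx_dom; eauto.
  - intros D g t G x A _ [H1 H2] _ _ _ H3; split.
    + apply incl_app; auto.
    + congruence.
  - intros G A t u i _ _ Ht _ Hu F1 F2.
    pose proof (sub_ctx_dom (@ps_src_sub i G)); pose proof (sub_ctx_dom (@ps_tgt_sub i G)).
    repeat apply incl_app; try (eapply incl_tran; eauto; fail).
    intros x Hx; apply H, F1, in_or_app; auto.
  - intros G A t u _ Ht _ Hu F1 F2; repeat apply incl_app; auto.
    intros x Hx; apply F1, in_or_app; auto.
Qed.

Lemma in_ctx_scoped G x A : wf_ctx G -> in_ctx x A G -> incl (ty_vars A) (dom G).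
Proof. intros H; now apply wf_scoped. Qed.

Lemma wf_ty_scoped G A : wf_ty G A -> incl (ty_vars A) (dom G).
Proof. apply wf_scoped. Qed.

Lemma wf_tm_scoped G t A : wf_tm G t A -> incl (tm_vars t) (dom G).
Proof. apply wf_scoped. Qed.

Lemma wf_sub_scoped D g G : wf_sub D g G -> incl (sub_vars g) (dom D).
Proof. intros H; now apply wf_scoped in H. Qed.

Lemma wf_sub_dom D g G : wf_sub D g G -> sub_dom g = dom G.
Proof. intros H; now apply wf_scoped in H. Qed.

Lemma valid_scoped k G A : valid k G A -> incl (ty_vars A) (dom G).
Proof. apply wf_scoped. Qed.

Lemma wf_sub_ctx D g G : wf_sub D g G -> wf_ctx D.
Proof. induction 1; auto. Qed.

Lemma wf_ty_ctx G A : wf_ty G A -> wf_ctx G.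
Proof. induction 1; auto. Qed.

Lemma wf_tm_ctx G t A : wf_tm G t A -> wf_ctx G.
Proof. destruct 1; eauto using wf_sub_ctx. Qed.

Lemma wf_sub_cod D g G : wf_sub D g G -> wf_ctx G.
Proof. destruct 1; auto using wf_cnil. Qed.

Lemma wf_sub_weaken :
  (forall G, wf_ctx G -> True) /\
  (forall G A, wf_ty G A -> forall H, wf_ctx H -> sub_ctx G H -> wf_ty H A) /\
  (forall G t A, wf_tm G t A -> forall H, wf_ctx H -> sub_ctx G H -> wf_tm H t A) /\
  (forall D g G, wf_sub D g G -> forall H, wf_ctx H -> sub_ctx D H -> wf_sub H g G) /\
  (forall k G A, valid k G A -> True).
Proof. apply wf_mind; intros; auto; try (constructor; auto; fail). Qed.

Lemma sub_ctx_cext G x A : sub_ctx G (cext G x A).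
Proof. intros ? ?; simpl; auto. Qed.

Lemma wf_lookup D g G x A :
  wf_sub D g G -> in_ctx x A G -> wf_tm D (lookup g x) (ty_sub A g).
Proof.
  induction 1 as [|D g t G y B Hg IH HG Ht]; [easy|].
  inversion HG as [|? ? ? HG' HB Hy]; subst.
  intros [[-> ->]|Hx].
  - rewrite ty_sub_sext; [simpl; now rewrite Nat.eqb_refl|].
    intros Hx; apply Hy; revert Hx; now apply wf_ty_scoped.
  - pose proof (in_ctx_dom Hx).
    rewrite ty_sub_sext, lookup_sext_ne; auto; [congruence|].
    intros Hx'; apply Hy; revert Hx'; eapply in_ctx_scoped; eauto.
Qed.

Lemma wf_subst :
  (forall G, wf_ctx G -> True) /\
  (forall G A, wf_ty G A -> forall D g, wf_sub D g G -> wf_ty D (ty_sub A g)) /\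
  (forall G t A, wf_tm G t A -> forall D g, wf_sub D g G ->
     wf_tm D (tm_sub t g) (ty_sub A g)) /\
  (forall D g G, wf_sub D g G -> forall E h, wf_sub E h D ->
     wf_sub E (sub_comp g h) G) /\
  (forall k G A, valid k G A -> True).
Proof.
  apply wf_mind; simpl; auto.
  - intros; constructor; eapply wf_sub_ctx; eauto.
  - intros; constructor; auto.
  - intros; eapply wf_lookup; eauto.
  - intros D k G A g HG HA _ Hg IH E h Hh.
    rewrite ty_sub_sub; [constructor; auto|].
    rewrite (wf_sub_dom Hg); eapply valid_scoped; eauto.
  - intros; constructor; eapply wf_sub_ctx; eauto.
  - intros D g t G x A Hg IHg HG _ Ht IHt E h Hh; constructor; auto.
    rewrite <- ty_sub_sub; auto.
    rewrite (wf_sub_dom Hg); inversion HG; eapply wf_ty_scoped; eauto.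
Qed.

Lemma wf_sub_id G : wf_ctx G -> wf_sub G (sub_id G) G.
Proof.
  induction 1 as [|G x A HG IH HA Hx]; simpl; [repeat constructor|].
  assert (wf_ctx (cext G x A)) by (constructor; auto).
  constructor; auto.
  - eapply wf_sub_weaken; eauto using sub_ctx_cext.
  - rewrite ty_sub_id; constructor; simpl; auto.
Qed.

Lemma wf_sub_wk G x A : wf_ctx (cext G x A) -> wf_sub (cext G x A) (sub_id G) G.
Proof. intros H; apply wf_sub_id in H; now inversion H. Qed.

Lemma sub_comp_wk G g x t :
  ~ In x (dom G) -> sub_comp (sub_id G) (sext g x t) = sub_comp (sub_id G) g.
Proof.
  intros H; apply sub_comp_sext; intros H'; apply H.
  revert H'; clear H; induction G as [|G IH y A]; simpl; auto.
  rewrite in_app_iff; simpl; tauto.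
Qed.

Lemma sub_comp_idl D g G : wf_sub D g G -> sub_comp (sub_id G) g = g.
Proof.
  induction 1 as [|D g t G x A Hg IH HG Ht]; simpl; auto.
  inversion HG; subst.
  rewrite sub_comp_wk, IH, Nat.eqb_refl; auto.
Qed.

Lemma ps_at_wf G x A : ps_at G x A ->
  (wf_ctx G /\ forall y, In y (dom G) -> y < ctx_len G) /\ wf_ty G A /\ wf_tm G (Var x) A.
Proof.
  induction 1 as [|G x A _ [[HG Hl] [HA Hx]] y f|G f A x y _ [[HG Hl] [HA Hx]]].
  - assert (wf_ctx (cext cnil 0 Star)) by (repeat constructor; auto).
    split; [split; auto|split; constructor; simpl; auto].
    simpl; intros z [<-|[]]; auto.
  - assert (HG1 : wf_ctx (cext G y A)).
    { constructor; auto; intros H; apply Hl in H; unfold y in H; lia. }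
    assert (HB : wf_ty (cext G y A) (Arr A (Var x) (Var y))).
    { constructor.
      - eapply wf_sub_weaken; eauto using sub_ctx_cext.
      - eapply wf_sub_weaken; eauto using sub_ctx_cext.
      - constructor; simpl; auto. }
    assert (HG2 : wf_ctx (cext (cext G y A) f (Arr A (Var x) (Var y)))).
    { constructor; auto; simpl; unfold f, y; intros [H|H]; [lia|apply Hl in H; lia]. }
    repeat split; auto.
    + simpl; unfold f, y; intros z [<-|[<-|H]]; [lia|lia|apply Hl in H; lia].
    + eapply wf_sub_weaken; eauto using sub_ctx_cext.
    + constructor; simpl; auto.
  - inversion HA; subst; auto.
Qed.

Lemma ps_wf G : ps G -> wf_ctx G.
Proof. intros [x H]; now apply ps_at_wf in H. Qed.

Lemma in_ctx_wf G x A : wf_ctx G -> in_ctx x A G -> wf_ty G A.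
Proof.
  intros HG; revert x A; induction HG as [|G y B HG IH HB Hy]; simpl; [easy|].
  intros x A Hx.
  assert (wf_ctx (cext G y B)) by (constructor; auto).
  destruct Hx as [[-> ->]|Hx]; eapply wf_sub_weaken; eauto using sub_ctx_cext.
Qed.

Lemma wf_presup :
  (forall G, wf_ctx G -> True) /\
  (forall G A, wf_ty G A -> True) /\
  (forall G t A, wf_tm G t A -> wf_ty G A) /\
  (forall D g G, wf_sub D g G -> True) /\
  (forall k G A, valid k G A -> ps G -> wf_ty G A).
Proof.
  apply wf_mind; auto.
  - intros; eapply in_ctx_wf; eauto.
  - intros D k G A g HG HA IH Hg _; eapply wf_subst; eauto.
  - intros G A t u i _ Ht IHt Hu _ _ _ HG; apply ps_wf in HG.
    constructor; eapply wf_sub_weaken; eauto using ps_src_sub, ps_tgt_sub.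
  - intros; constructor; auto.
Qed.

Lemma valid_wf k G A : ps G -> valid k G A -> wf_ty G A.
Proof. intros HG HA; destruct wf_presup as (_ & _ & _ & _ & H); eauto. Qed.

Lemma valid_arr k G A : valid k G A -> exists B t u, A = Arr B t u.
Proof. destruct 1; eauto. Qed.

(** [MTt] is the term () and [MOne] its type; the type ⋆ of MCaTT is
    [MArr MOne MTt MTt].  The constructors mop and mcoh are indexed by a
    ps-context and a type of CaTT. *)

Inductive mtm : Set :=
| MVar (x : nat)
| MTt
| MCon (k : kind) (G : ctx) (A : ty) (g : msub)
with msub : Set :=
| msnil
| msext (g : msub) (x : nat) (t : mtm).

Inductive mty : Set :=
| MOne
| MArr (A : mty) (t u : mtm).

Inductive mctx : Set :=
| mcnil
| mcext (G : mctx) (x : nat) (A : mty).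

Scheme mtm_mind := Induction for mtm Sort Prop
with msub_mind := Induction for msub Sort Prop.
Combined Scheme mtm_sub_mind from mtm_mind, msub_mind.

Fixpoint mlookup (g : msub) (x : nat) : mtm :=
  match g with
  | msnil => MVar x
  | msext g y t => if x =? y then t else mlookup g x
  end.

Fixpoint mtm_sub (t : mtm) (g : msub) : mtm :=
  match t with
  | MVar x => mlookup g x
  | MTt => MTt
  | MCon k G A d => MCon k G A (msub_comp d g)
  end
with msub_comp (d g : msub) : msub :=
  match d with
  | msnil => msnil
  | msext d x t => msext (msub_comp d g) x (mtm_sub t g)
  end.

Fixpoint mty_sub (A : mty) (g : msub) : mty :=
  match A with
  | MOne => MOne
  | MArr A t u => MArr (mty_sub A g) (mtm_sub t g) (mtm_sub u g)
  end.

Fixpoint msub_id (G : mctx) : msub :=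
  match G with
  | mcnil => msnil
  | mcext G x _ => msext (msub_id G) x (MVar x)
  end.

Fixpoint mdom (G : mctx) : list nat :=
  match G with
  | mcnil => []
  | mcext G x _ => x :: mdom G
  end.

Fixpoint in_mctx (x : nat) (A : mty) (G : mctx) : Prop :=
  match G with
  | mcnil => False
  | mcext G y B => (x = y /\ A = B) \/ in_mctx x A G
  end.

(** The desuspension replaces ⋆ by 1, op by mop and coh by mcoh; the index of a
    term constructor is left untouched. *)

Fixpoint D_tm (t : tm) : mtm :=
  match t with
  | Var x => MVar x
  | Con k G A g => MCon k G A (D_sub g)
  end
with D_sub (g : sub) : msub :=
  match g with
  | snil => msnil
  | sext g x t => msext (D_sub g) x (D_tm t)
  end.

Fixpoint D_ty (A : ty) : mty :=
  match A with
  | Star => MOne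
  | Arr A t u => MArr (D_ty A) (D_tm t) (D_tm u)
  end.

Fixpoint D_ctx (G : ctx) : mctx :=
  match G with
  | cnil => mcnil
  | cext G x A => mcext (D_ctx G) x (D_ty A)
  end.

Inductive mwf_ctx : mctx -> Prop :=
| mwf_cnil : mwf_ctx mcnil
| mwf_cext G x A : mwf_ctx G -> mwf_ty G A -> ~ In x (mdom G) ->
    mwf_ctx (mcext G x A)
with mwf_ty : mctx -> mty -> Prop :=
| mwf_One G : mwf_ctx G -> mwf_ty G MOne
| mwf_Arr G A t u : mwf_ty G A -> mwf_tm G t A -> mwf_tm G u A ->
    mwf_ty G (MArr A t u)
with mwf_tm : mctx -> mtm -> mty -> Prop :=
| mwf_Var G x A : mwf_ctx G -> in_mctx x A G -> mwf_tm G (MVar x) A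
| mwf_Tt G : mwf_ctx G -> mwf_tm G MTt MOne
| mwf_Con D k G A g : ps G -> valid k G A -> mwf_sub D g (D_ctx G) ->
    mwf_tm D (MCon k G A g) (mty_sub (D_ty A) g)
| mwf_conv G t A B : mwf_tm G t A -> meq_ty G A B -> mwf_tm G t B
with mwf_sub : mctx -> msub -> mctx -> Prop :=
| mwf_snil D : mwf_ctx D -> mwf_sub D msnil mcnil
| mwf_sext D g t G x A : mwf_sub D g G -> mwf_ctx (mcext G x A) ->
    mwf_tm D t (mty_sub A g) -> mwf_sub D (msext g x t) (mcext G x A)
with meq_ty : mctx -> mty -> mty -> Prop :=
| meq_ty_refl G A : mwf_ty G A -> meq_ty G A A
| meq_ty_sym G A B : meq_ty G A B -> meq_ty G B A
| meq_ty_trans G A B C : meq_ty G A B -> meq_ty G B C -> meq_ty G A C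
| meq_Arr G A A' t t' u u' : meq_ty G A A' -> meq_tm G t t' A -> meq_tm G u u' A ->
    meq_ty G (MArr A t u) (MArr A' t' u')
with meq_tm : mctx -> mtm -> mtm -> mty -> Prop :=
| meq_tm_refl G t A : mwf_tm G t A -> meq_tm G t t A
| meq_tm_sym G t u A : meq_tm G t u A -> meq_tm G u t A
| meq_tm_trans G t u v A : meq_tm G t u A -> meq_tm G u v A -> meq_tm G t v A
| meq_conv G t u A B : meq_tm G t u A -> meq_ty G A B -> meq_tm G t u B
| meq_eta G t : mwf_tm G t MOne -> meq_tm G t MTt MOne
| meq_Con D k G A g h : ps G -> valid k G A -> meq_sub D g h (D_ctx G) ->
    meq_tm D (MCon k G A g) (MCon k G A h) (mty_sub (D_ty A) g)
with meq_sub : mctx -> msub -> msub -> mctx -> Prop :=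
| meq_snil D : mwf_ctx D -> meq_sub D msnil msnil mcnil
| meq_sext D g h t u G x A : meq_sub D g h G -> mwf_ctx (mcext G x A) ->
    meq_tm D t u (mty_sub A g) -> meq_sub D (msext g x t) (msext h x u) (mcext G x A).

Scheme mwf_ctx_mind := Minimality for mwf_ctx Sort Prop
with mwf_ty_mind := Minimality for mwf_ty Sort Prop
with mwf_tm_mind := Minimality for mwf_tm Sort Prop
with mwf_sub_mind := Minimality for mwf_sub Sort Prop
with meq_ty_mind := Minimality for meq_ty Sort Prop
with meq_tm_mind := Minimality for meq_tm Sort Prop
with meq_sub_mind := Minimality for meq_sub Sort Prop.
Combined Scheme mwf_mind from mwf_ctx_mind, mwf_ty_mind, mwf_tm_mind, mwf_sub_mind,
  meq_ty_mind, meq_tm_mind, meq_sub_mind.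

Fixpoint mtm_vars (t : mtm) : list nat :=
  match t with
  | MVar x => [x]
  | MTt => []
  | MCon _ _ _ g => msub_vars g
  end
with msub_vars (g : msub) : list nat :=
  match g with
  | msnil => []
  | msext g _ t => msub_vars g ++ mtm_vars t
  end.

Fixpoint mty_vars (A : mty) : list nat :=
  match A with
  | MOne => []
  | MArr A t u => mty_vars A ++ mtm_vars t ++ mtm_vars u
  end.

Fixpoint msub_dom (g : msub) : list nat :=
  match g with
  | msnil => []
  | msext g x _ => x :: msub_dom g
  end.

Lemma mtm_sub_sub_gen g h k :
  (forall t, (forall x, In x (mtm_vars t) -> mtm_sub (mlookup g x) h = mlookup k x) ->
     mtm_sub (mtm_sub t g) h = mtm_sub t k) /\
  (forall d, (forall x, In x (msub_vars d) -> mtm_sub (mlookup g x) h = mlookup k x) ->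
     msub_comp (msub_comp d g) h = msub_comp d k).
Proof.
  apply mtm_sub_mind; simpl; auto.
  - intros k0 G A d IH H; now rewrite IH.
  - intros d IHd x t IHt H.
    rewrite IHd, IHt; auto; intros; apply H, in_or_app; auto.
Qed.

Lemma mty_sub_sub_gen g h k A :
  (forall x, In x (mty_vars A) -> mtm_sub (mlookup g x) h = mlookup k x) ->
  mty_sub (mty_sub A g) h = mty_sub A k.
Proof.
  induction A as [|A IH t u]; simpl; auto; intros H.
  rewrite IH, !(proj1 (mtm_sub_sub_gen g h k)); auto;
    intros; apply H; rewrite !in_app_iff; auto.
Qed.

Lemma mtm_sub_agree g h :
  (forall t, (forall x, In x (mtm_vars t) -> mlookup g x = mlookup h x) ->
     mtm_sub t g = mtm_sub t h) /\
  (forall d, (forall x, In x (msub_vars d) -> mlookup g x = mlookup h x) ->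
     msub_comp d g = msub_comp d h).
Proof.
  apply mtm_sub_mind; simpl; auto.
  - intros k0 G A d IH H; now rewrite IH.
  - intros d IHd x t IHt H.
    rewrite IHd, IHt; auto; intros; apply H, in_or_app; auto.
Qed.

Lemma mty_sub_agree g h A :
  (forall x, In x (mty_vars A) -> mlookup g x = mlookup h x) -> mty_sub A g = mty_sub A h.
Proof.
  induction A as [|A IH t u]; simpl; auto; intros H.
  rewrite IH, !(proj1 (mtm_sub_agree g h)); auto;
    intros; apply H; rewrite !in_app_iff; auto.
Qed.

Lemma mtm_sub_var g (H : forall x, mlookup g x = MVar x) :
  (forall t, mtm_sub t g = t) /\ (forall d, msub_comp d g = d).
Proof.
  apply mtm_sub_mind; simpl; auto.
  - intros k0 G A d IH; now rewrite IH.
  - intros d IHd x t IHt; now rewrite IHd, IHt.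
Qed.

Lemma mlookup_id G x : mlookup (msub_id G) x = MVar x.
Proof.
  induction G as [|G IH y A]; simpl; auto.
  destruct (Nat.eqb_spec x y); subst; auto.
Qed.

Lemma mtm_sub_id t G : mtm_sub t (msub_id G) = t.
Proof. apply mtm_sub_var, mlookup_id. Qed.

Lemma msub_comp_idr d G : msub_comp d (msub_id G) = d.
Proof. apply mtm_sub_var, mlookup_id. Qed.

Lemma mty_sub_id A G : mty_sub A (msub_id G) = A.
Proof. induction A; simpl; rewrite ?mtm_sub_id; congruence. Qed.

Lemma mlookup_comp g h x :
  In x (msub_dom g) -> mlookup (msub_comp g h) x = mtm_sub (mlookup g x) h.
Proof.
  induction g as [|g IH y t]; simpl; [easy|].
  destruct (Nat.eqb_spec x y); auto.
  intros [->|]; [easy|auto].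
Qed.

Lemma mtm_sub_sub t g h :
  incl (mtm_vars t) (msub_dom g) -> mtm_sub (mtm_sub t g) h = mtm_sub t (msub_comp g h).
Proof. intros H; apply mtm_sub_sub_gen; intros; symmetry; apply mlookup_comp; auto. Qed.

Lemma msub_comp_assoc d g h :
  incl (msub_vars d) (msub_dom g) ->
  msub_comp (msub_comp d g) h = msub_comp d (msub_comp g h).
Proof. intros H; apply mtm_sub_sub_gen; intros; symmetry; apply mlookup_comp; auto. Qed.

Lemma mty_sub_sub A g h :
  incl (mty_vars A) (msub_dom g) -> mty_sub (mty_sub A g) h = mty_sub A (msub_comp g h).
Proof. intros H; apply mty_sub_sub_gen; intros; symmetry; apply mlookup_comp; auto. Qed.

Lemma mlookup_sext_ne g x t y : x <> y -> mlookup (msext g x t) y = mlookup g y.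
Proof. intros H; simpl; destruct (Nat.eqb_spec y x); congruence. Qed.

Lemma mty_sub_sext A g x t : ~ In x (mty_vars A) -> mty_sub A (msext g x t) = mty_sub A g.
Proof. intros H; apply mty_sub_agree; intros; apply mlookup_sext_ne; congruence. Qed.

Lemma msub_comp_sext d g x t :
  ~ In x (msub_vars d) -> msub_comp d (msext g x t) = msub_comp d g.
Proof. intros H; apply mtm_sub_agree; intros; apply mlookup_sext_ne; congruence. Qed.

Lemma D_vars :
  (forall t, mtm_vars (D_tm t) = tm_vars t) /\ (forall g, msub_vars (D_sub g) = sub_vars g).
Proof. apply tm_sub_mind; simpl; auto; intros; congruence. Qed.

Lemma D_ty_vars A : mty_vars (D_ty A) = ty_vars A.
Proof. induction A; simpl; rewrite ?(proj1 D_vars); congruence. Qed.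

Lemma D_ctx_dom G : mdom (D_ctx G) = dom G.
Proof. induction G; simpl; congruence. Qed.

Lemma in_mctx_dom x A G : in_mctx x A G -> In x (mdom G).
Proof. induction G; simpl; [easy|]; intuition. Qed.

Lemma D_valid_scoped k G A : valid k G A -> incl (mty_vars (D_ty A)) (mdom (D_ctx G)).
Proof. rewrite D_ty_vars, D_ctx_dom; apply valid_scoped. Qed.

Lemma mwf_scoped :
  (forall G, mwf_ctx G -> forall x A, in_mctx x A G -> incl (mty_vars A) (mdom G)) /\
  (forall G A, mwf_ty G A -> incl (mty_vars A) (mdom G)) /\
  (forall G t A, mwf_tm G t A -> incl (mtm_vars t) (mdom G)) /\
  (forall D g G, mwf_sub D g G -> incl (msub_vars g) (mdom D) /\ msub_dom g = mdom G) /\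
  (forall G A B, meq_ty G A B -> True) /\
  (forall G t u A, meq_tm G t u A -> True) /\
  (forall D g h G, meq_sub D g h G -> msub_dom g = mdom G /\ msub_dom h = mdom G).
Proof.
  apply mwf_mind; simpl; try easy.
  - intros G x A _ IHG _ IHA _ y B [[-> ->]|H]; apply incl_tl; eauto.
  - intros; repeat apply incl_app; auto.
  - intros G x A _ _ H y [<-|[]]; eapply in_mctx_dom; eauto.
  - intros D g t G x A _ [H1 H2] _ _ _ H3; split.
    + apply incl_app; auto.
    + congruence.
  - intros D g h t u G x A _ [-> ->] _ _ _ _; auto.
Qed.

Lemma in_mctx_scoped G x A : mwf_ctx G -> in_mctx x A G -> incl (mty_vars A) (mdom G).
Proof. intros H; now apply mwf_scoped. Qed.

Lemma mwf_ty_scoped G A : mwf_ty G A -> incl (mty_vars A) (mdom G).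
Proof. apply mwf_scoped. Qed.

Lemma mwf_tm_scoped G t A : mwf_tm G t A -> incl (mtm_vars t) (mdom G).
Proof. apply mwf_scoped. Qed.

Lemma mwf_sub_scoped D g G : mwf_sub D g G -> incl (msub_vars g) (mdom D).
Proof. intros H; now apply mwf_scoped in H. Qed.

Lemma mwf_sub_dom D g G : mwf_sub D g G -> msub_dom g = mdom G.
Proof. intros H; now apply mwf_scoped in H. Qed.

Lemma meq_sub_dom D g h G : meq_sub D g h G -> msub_dom g = mdom G.
Proof. intros H; now apply mwf_scoped in H. Qed.

Lemma mwf_sub_ctx D g G : mwf_sub D g G -> mwf_ctx D.
Proof. induction 1; auto. Qed.

Lemma mwf_ty_ctx G A : mwf_ty G A -> mwf_ctx G.
Proof. induction 1; auto. Qed.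

Lemma mwf_sub_cod D g G : mwf_sub D g G -> mwf_ctx G.
Proof. destruct 1; auto using mwf_cnil. Qed.

Definition sub_mctx (G H : mctx) : Prop := forall x A, in_mctx x A G -> in_mctx x A H.

Lemma sub_mctx_cext G x A : sub_mctx G (mcext G x A).
Proof. intros ? ?; simpl; auto. Qed.

Lemma mwf_weaken :
  (forall G, mwf_ctx G -> True) /\
  (forall G A, mwf_ty G A -> forall H, mwf_ctx H -> sub_mctx G H -> mwf_ty H A) /\
  (forall G t A, mwf_tm G t A -> forall H, mwf_ctx H -> sub_mctx G H -> mwf_tm H t A) /\
  (forall D g G, mwf_sub D g G -> forall H, mwf_ctx H -> sub_mctx D H -> mwf_sub H g G) /\
  (forall G A B, meq_ty G A B -> forall H, mwf_ctx H -> sub_mctx G H -> meq_ty H A B) /\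
  (forall G t u A, meq_tm G t u A ->
     forall H, mwf_ctx H -> sub_mctx G H -> meq_tm H t u A) /\
  (forall D g h G, meq_sub D g h G ->
     forall H, mwf_ctx H -> sub_mctx D H -> meq_sub H g h G).
Proof.
  apply mwf_mind; intros; auto; try (constructor; auto; fail).
  - eapply mwf_conv; eauto.
  - eapply meq_ty_trans; eauto.
  - eapply meq_tm_trans; eauto.
  - eapply meq_conv; eauto.
Qed.

Lemma mwf_lookup D g G x A :
  mwf_sub D g G -> in_mctx x A G -> mwf_tm D (mlookup g x) (mty_sub A g).
Proof.
  induction 1 as [|D g t G y B Hg IH HG Ht]; [easy|].
  inversion HG as [|? ? ? HG' HB Hy]; subst.
  intros [[-> ->]|Hx].
  - rewrite mty_sub_sext; [simpl; now rewrite Nat.eqb_refl|].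
    intros Hx; apply Hy; revert Hx; now apply mwf_ty_scoped.
  - pose proof (in_mctx_dom Hx).
    rewrite mty_sub_sext, mlookup_sext_ne; auto; [congruence|].
    intros Hx'; apply Hy; revert Hx'; eapply in_mctx_scoped; eauto.
Qed.

Lemma meq_lookup D g h G x A :
  meq_sub D g h G -> in_mctx x A G -> meq_tm D (mlookup g x) (mlookup h x) (mty_sub A g).
Proof.
  induction 1 as [|D g h t u G y B Hg IH HG Ht]; [easy|].
  inversion HG as [|? ? ? HG' HB Hy]; subst.
  intros [[-> ->]|Hx].
  - rewrite mty_sub_sext; [simpl; now rewrite Nat.eqb_refl|].
    intros Hx; apply Hy; revert Hx; now apply mwf_ty_scoped.
  - pose proof (in_mctx_dom Hx).
    rewrite mty_sub_sext, !mlookup_sext_ne; auto; try congruence.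
    intros Hx'; apply Hy; revert Hx'; eapply in_mctx_scoped; eauto.
Qed.

Lemma mwf_subst :
  (forall G, mwf_ctx G -> True) /\
  (forall G A, mwf_ty G A -> forall D g, mwf_sub D g G -> mwf_ty D (mty_sub A g)) /\
  (forall G t A, mwf_tm G t A -> forall D g, mwf_sub D g G ->
     mwf_tm D (mtm_sub t g) (mty_sub A g)) /\
  (forall D g G, mwf_sub D g G -> forall E h, mwf_sub E h D ->
     mwf_sub E (msub_comp g h) G) /\
  (forall G A B, meq_ty G A B -> forall D g, mwf_sub D g G ->
     meq_ty D (mty_sub A g) (mty_sub B g)) /\
  (forall G t u A, meq_tm G t u A -> forall D g, mwf_sub D g G ->
     meq_tm D (mtm_sub t g) (mtm_sub u g) (mty_sub A g)) /\
  (forall D g h G, meq_sub D g h G -> forall E k, mwf_sub E k D ->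
     meq_sub E (msub_comp g k) (msub_comp h k) G).
Proof.
  apply mwf_mind; simpl; auto; try (intros; constructor; eauto using mwf_sub_ctx; fail).
  - intros; eapply mwf_lookup; eauto.
  - intros D k G A g HG HA Hg IH E h Hh.
    rewrite mty_sub_sub; [constructor; auto|].
    rewrite (mwf_sub_dom Hg); eapply D_valid_scoped; eauto.
  - intros; eapply mwf_conv; eauto.
  - intros D g t G x A Hg IHg HG _ Ht IHt E h Hh; constructor; auto.
    rewrite <- mty_sub_sub; auto.
    rewrite (mwf_sub_dom Hg); inversion HG; eapply mwf_ty_scoped; eauto.
  - intros; eapply meq_ty_trans; eauto.
  - intros; eapply meq_tm_trans; eauto.
  - intros; eapply meq_conv; eauto.
  - intros D k G A g g' HG HA Hg IH E h Hh.
    rewrite mty_sub_sub; [apply meq_Con; auto|].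
    rewrite (meq_sub_dom Hg); eapply D_valid_scoped; eauto.
  - intros D g g' t u G x A Hg IHg HG _ Ht IHt E h Hh; constructor; auto.
    rewrite <- mty_sub_sub; auto.
    rewrite (meq_sub_dom Hg); inversion HG; eapply mwf_ty_scoped; eauto.
Qed.

Lemma mwf_functional :
  (forall G, mwf_ctx G -> True) /\
  (forall G A, mwf_ty G A -> forall D g h, mwf_sub D g G -> meq_sub D g h G ->
     meq_ty D (mty_sub A g) (mty_sub A h)) /\
  (forall G t A, mwf_tm G t A -> forall D g h, mwf_sub D g G -> meq_sub D g h G ->
     meq_tm D (mtm_sub t g) (mtm_sub t h) (mty_sub A g)) /\
  (forall D g G, mwf_sub D g G -> forall E h k, mwf_sub E h D -> meq_sub E h k D ->
     meq_sub E (msub_comp g h) (msub_comp g k) G) /\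
  (forall G A B, meq_ty G A B -> True) /\
  (forall G t u A, meq_tm G t u A -> True) /\
  (forall D g h G, meq_sub D g h G -> True).
Proof.
  apply mwf_mind; simpl; auto.
  - intros; apply meq_ty_refl, mwf_One; eapply mwf_sub_ctx; eauto.
  - intros; apply meq_Arr; auto.
  - intros; eapply meq_lookup; eauto.
  - intros; apply meq_tm_refl, mwf_Tt; eapply mwf_sub_ctx; eauto.
  - intros D k G A g HG HA Hg IH E h h' Hh Hh'.
    rewrite mty_sub_sub; [apply meq_Con; auto|].
    rewrite (mwf_sub_dom Hg); eapply D_valid_scoped; eauto.
  - intros G t A B Ht IHt HAB _ D g h Hg Hh.
    eapply meq_conv; [eauto|eapply mwf_subst; eauto].
  - intros; constructor; eapply mwf_sub_ctx; eauto.
  - intros D g t G x A Hg IHg HG _ Ht IHt E h k Hh Hk; constructor; auto.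
    rewrite <- mty_sub_sub; auto.
    rewrite (mwf_sub_dom Hg); inversion HG; eapply mwf_ty_scoped; eauto.
Qed.

Lemma meq_sub_refl D g G : mwf_sub D g G -> meq_sub D g g G.
Proof. induction 1; constructor; auto; now apply meq_tm_refl. Qed.

Lemma meq_ty_functional D g h G A :
  mwf_ty G A -> mwf_sub D g G -> meq_sub D g h G ->
  meq_ty D (mty_sub A g) (mty_sub A h).
Proof. intros H; revert D g h; now apply mwf_functional. Qed.

Lemma meq_sub_sym D g h G : mwf_sub D g G -> meq_sub D g h G -> meq_sub D h g G.
Proof.
  intros Hg H; induction H as [|D g h t u G x A H IH HG Ht]; [now constructor|].
  inversion Hg; inversion HG; subst; constructor; auto.
  eapply meq_conv; [apply meq_tm_sym; eauto|eapply meq_ty_functional; eauto].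
Qed.

Lemma meq_sub_trans D g h k G :
  mwf_sub D g G -> meq_sub D g h G -> meq_sub D h k G -> meq_sub D g k G.
Proof.
  intros Hg H; revert k; induction H as [|D g h t u G x A H IH HG Ht]; intros k K.
  - inversion K; subst; now constructor.
  - inversion Hg; inversion HG; inversion K; subst; constructor; auto.
    eapply meq_tm_trans; eauto.
    eapply meq_conv; eauto.
    apply meq_ty_sym; eapply meq_ty_functional; eauto.
Qed.

Lemma mwf_sub_id G : mwf_ctx G -> mwf_sub G (msub_id G) G.
Proof.
  induction 1 as [|G x A HG IH HA Hx]; simpl; [repeat constructor|].
  assert (mwf_ctx (mcext G x A)) by (constructor; auto).
  constructor; auto.
  - eapply mwf_weaken; eauto using sub_mctx_cext.
  - rewrite mty_sub_id; constructor; simpl; auto.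
Qed.

Lemma mwf_sub_wk G x A : mwf_ctx (mcext G x A) -> mwf_sub (mcext G x A) (msub_id G) G.
Proof. intros H; apply mwf_sub_id in H; now inversion H. Qed.

Lemma msub_comp_wk G g x t :
  ~ In x (mdom G) -> msub_comp (msub_id G) (msext g x t) = msub_comp (msub_id G) g.
Proof.
  intros H; apply msub_comp_sext; intros H'; apply H.
  revert H'; clear H; induction G as [|G IH y A]; simpl; auto.
  rewrite in_app_iff; simpl; tauto.
Qed.

Lemma msub_comp_idl D g G : mwf_sub D g G -> msub_comp (msub_id G) g = g.
Proof.
  induction 1 as [|D g t G x A Hg IH HG Ht]; simpl; auto.
  inversion HG; subst.
  rewrite msub_comp_wk, IH, Nat.eqb_refl; auto.
Qed.

Lemma D_lookup g x : D_tm (lookup g x) = mlookup (D_sub g) x.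
Proof. induction g; simpl; auto; destruct (x =? x0); auto. Qed.

Lemma D_subst g :
  (forall t, D_tm (tm_sub t g) = mtm_sub (D_tm t) (D_sub g)) /\
  (forall d, D_sub (sub_comp d g) = msub_comp (D_sub d) (D_sub g)).
Proof. apply tm_sub_mind; simpl; intros; auto using D_lookup; congruence. Qed.

Lemma D_ty_sub A g : D_ty (ty_sub A g) = mty_sub (D_ty A) (D_sub g).
Proof. induction A; simpl; rewrite ?(proj1 (D_subst g)); congruence. Qed.

Lemma D_sub_id G : D_sub (sub_id G) = msub_id (D_ctx G).
Proof. induction G; simpl; congruence. Qed.

Lemma D_in_ctx x A G : in_ctx x A G -> in_mctx x (D_ty A) (D_ctx G).
Proof. induction G; simpl; [easy|]; intuition congruence. Qed.

Lemma D_wf :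
  (forall G, wf_ctx G -> mwf_ctx (D_ctx G)) /\
  (forall G A, wf_ty G A -> mwf_ty (D_ctx G) (D_ty A)) /\
  (forall G t A, wf_tm G t A -> mwf_tm (D_ctx G) (D_tm t) (D_ty A)) /\
  (forall D g G, wf_sub D g G -> mwf_sub (D_ctx D) (D_sub g) (D_ctx G)) /\
  (forall k G A, valid k G A -> True).
Proof.
  apply wf_mind; simpl; auto; try (intros; constructor; auto; fail).
  - intros; constructor; auto; now rewrite D_ctx_dom.
  - intros; constructor; auto using D_in_ctx.
  - intros; rewrite D_ty_sub; constructor; auto.
  - intros; constructor; auto; now rewrite <- D_ty_sub.
Qed.

(** The variable [x] of MCaTT is sent to the variable [S x] of CaTT, which
    leaves [0] as a fresh name for the variable •. *)
Definition bullet : nat := 0.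

Definition is_star (A : ty) : bool := match A with Star => true | _ => false end.

Definition is_one (A : mty) : bool := match A with MOne => true | _ => false end.

Fixpoint has_type_one (G : mctx) (x : nat) : bool :=
  match G with
  | mcnil => false
  | mcext G y A => if x =? y then is_one A else has_type_one G x
  end.

(** The substitution •_G from the reduced suspension of the desuspension of
    [G] to [G]. *)
Fixpoint collapse (G : ctx) : sub :=
  match G with
  | cnil => snil
  | cext G x A => sext (collapse G) x (Var (if is_star A then bullet else S x))
  end.

(** [S_tm G t] translates [t] in context [G]; [S_sub D g G] translates the
    substitution [g] from [D] to [G]. *)
Fixpoint S_tm (G : mctx) (t : mtm) : tm :=
  match t with
  | MVar x => Var (if has_type_one G x then bullet else S x)
  | MTt => Var bullet
  | MCon k Th A g => Con k Th A (sub_comp (collapse Th) (S_sub G g (D_ctx Th)))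
  end
with S_sub (D : mctx) (g : msub) (G : mctx) : sub :=
  match g, G with
  | msext g x t, mcext G _ A =>
      if is_one A then S_sub D g G else sext (S_sub D g G) (S x) (S_tm D t)
  | _, _ => sext snil bullet (Var bullet)
  end.

Fixpoint S_ty (G : mctx) (A : mty) : ty :=
  match A with
  | MOne => Star
  | MArr A t u => Arr (S_ty G A) (S_tm G t) (S_tm G u)
  end.

Fixpoint S_ctx (G : mctx) : ctx :=
  match G with
  | mcnil => cext cnil bullet Star
  | mcext G x A => if is_one A then S_ctx G else cext (S_ctx G) (S x) (S_ty G A)
  end.

Lemma S_tm_agree G H :
  (forall t, (forall x, In x (mtm_vars t) -> has_type_one G x = has_type_one H x) ->
     S_tm G t = S_tm H t) /\
  (forall g, (forall x, In x (msub_vars g) -> has_type_one G x = has_type_one H x) ->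
     forall K, S_sub G g K = S_sub H g K).
Proof.
  apply mtm_sub_mind; simpl; auto.
  - intros x E; rewrite E; auto.
  - intros k Th A g IH E; now rewrite IH.
  - intros g IHg x t IHt E [|K y A]; auto.
    rewrite IHg, IHt; auto; intros; apply E, in_or_app; auto.
Qed.

Lemma S_ty_agree G H A :
  (forall x, In x (mty_vars A) -> has_type_one G x = has_type_one H x) ->
  S_ty G A = S_ty H A.
Proof.
  induction A as [|A IH t u]; simpl; auto; intros E.
  rewrite IH, !(proj1 (S_tm_agree G H)); auto;
    intros; apply E; rewrite !in_app_iff; auto.
Qed.

Lemma has_type_one_ne G x A y : y <> x -> has_type_one (mcext G x A) y = has_type_one G y.
Proof. intros H; simpl; destruct (Nat.eqb_spec y x); congruence. Qed.

Lemma S_ty_cext G x A B : ~ In x (mty_vars B) -> S_ty (mcext G x A) B = S_ty G B.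
Proof. intros H; apply S_ty_agree; intros; apply has_type_one_ne; congruence. Qed.

Lemma S_sub_cext D x A g G :
  ~ In x (msub_vars g) -> S_sub (mcext D x A) g G = S_sub D g G.
Proof. intros H; apply S_tm_agree; intros; apply has_type_one_ne; congruence. Qed.

Lemma has_type_one_in G x A : mwf_ctx G -> in_mctx x A G -> has_type_one G x = is_one A.
Proof.
  intros HG; revert x A; induction HG as [|G y B HG IH HB Hy]; simpl; [easy|].
  intros x A [[-> ->]|Hx]; [now rewrite Nat.eqb_refl|].
  destruct (Nat.eqb_spec x y); subst; auto.
  now apply in_mctx_dom in Hx.
Qed.

(** [g] binds the variables of [G], and its components at the variables of type
    [MOne] are sent to •. *)
Fixpoint S_good (D : mctx) (g : msub) (G : mctx) : Prop :=
  match g, G with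
  | msnil, mcnil => True
  | msext g x t, mcext G y A =>
      S_good D g G /\ x = y /\ (A = MOne -> S_tm D t = Var bullet)
  | _, _ => False
  end.

Lemma S_lookup_bullet D g G : lookup (S_sub D g G) bullet = Var bullet.
Proof.
  revert G; induction g as [|g IH x t]; intros [|G y A]; simpl; auto.
  destruct (is_one A); simpl; auto.
Qed.

Lemma S_lookup D g G x :
  S_good D g G -> In x (mdom G) ->
  S_tm D (mlookup g x) =
  lookup (S_sub D g G) (if has_type_one G x then bullet else S x).
Proof.
  revert G; induction g as [|g IH y t]; intros [|G z A]; simpl; try easy.
  intros (Hg & -> & HA) Hx.
  destruct (Nat.eqb_spec x z) as [->|Hne].
  - destruct A; simpl; [rewrite S_lookup_bullet; auto|].
    now rewrite Nat.eqb_refl.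
  - rewrite (IH G); auto; [|intuition congruence].
    destruct A; simpl; auto.
    destruct (has_type_one G x); simpl; auto.
    destruct (Nat.eqb_spec x z); congruence.
Qed.

Lemma S_sub_dom D g G :
  S_good D g G -> forall x, In x (sub_dom (S_sub D g G)) <-> In x (dom (S_ctx G)).
Proof.
  revert G; induction g as [|g IH y t]; intros [|G z A]; simpl; try easy.
  intros (Hg & -> & HA) x; destruct A; simpl; auto.
  rewrite IH; tauto.
Qed.

Lemma S_ctx_dom G x : In x (dom (S_ctx G)) -> x = bullet \/ exists y, x = S y /\ In y (mdom G).
Proof.
  induction G as [|G IH y A]; simpl; [intuition|].
  intros H; assert (E : x = S y \/ In x (dom (S_ctx G))).
  { destruct (is_one A); simpl in H; intuition. }
  destruct E as [->|E]; [eauto|].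
  destruct (IH E) as [|[z [-> Hz]]]; eauto.
Qed.

Lemma collapse_vars G x :
  In x (sub_vars (collapse G)) -> x = bullet \/ exists y, x = S y /\ In y (dom G).
Proof.
  induction G as [|G IH y A]; simpl; [easy|].
  rewrite in_app_iff; simpl; intros [H|[<-|[]]].
  - destruct (IH H) as [|[z [-> Hz]]]; eauto.
  - destruct (is_star A); eauto.
Qed.

Lemma collapse_vars_dom G D g :
  S_good D g (D_ctx G) -> incl (sub_vars (collapse G)) (sub_dom (S_sub D g (D_ctx G))).
Proof.
  intros Hg x Hx; apply (S_sub_dom Hg); clear Hg.
  assert (B : In bullet (dom (S_ctx (D_ctx G)))).
  { clear; induction G as [|G IH y A]; simpl; auto; destruct (is_one (D_ty A)); simpl; auto. }
  revert Hx; induction G as [|G IH y A]; simpl in *; [easy|].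
  assert (B' : In bullet (dom (S_ctx (D_ctx G)))).
  { destruct A; simpl in B; auto; destruct B; easy. }
  rewrite in_app_iff; simpl.
  intros [Hx|[<-|[]]]; destruct A; simpl; auto.
Qed.

Lemma D_valid_arr k G A g : valid k G A -> mty_sub (D_ty A) g <> MOne.
Proof. intros H; destruct (valid_arr H) as (B & t & u & ->); easy. Qed.

Lemma is_one_spec A : is_one A = true -> A = MOne.
Proof. destruct A; easy. Qed.

Lemma S_wf_good :
  (forall G, mwf_ctx G -> True) /\
  (forall G A, mwf_ty G A -> True) /\
  (forall G t A, mwf_tm G t A -> A = MOne -> S_tm G t = Var bullet) /\
  (forall D g G, mwf_sub D g G -> S_good D g G) /\
  (forall G A B, meq_ty G A B -> S_ty G A = S_ty G B /\ (A = MOne <-> B = MOne)) /\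
  (forall G t u A, meq_tm G t u A -> S_tm G t = S_tm G u) /\
  (forall D g h G, meq_sub D g h G -> S_sub D g G = S_sub D h G).
Proof.
  apply mwf_mind; simpl; auto.
  - intros G x A HG _ Hx ->; now rewrite (has_type_one_in HG Hx).
  - intros D k G A g _ HA _ _ H; now destruct (D_valid_arr HA H).
  - intros G t A B _ IH _ [_ E] H; apply IH, E, H.
  - intros D g t G x A _ IHg _ _ _ IHt; repeat split; auto.
    intros ->; auto.
  - intuition.
  - intuition.
  - intros G A B C _ [E1 [F1 F1']] _ [E2 [F2 F2']]; intuition congruence.
  - intros G A A' t t' u u' _ [E _] _ Et _ Eu; split; [congruence|easy].
  - intros; congruence.
  - intros; congruence.
  - intros D g h t u G x A _ E _ _ _ Et; rewrite E, Et; auto.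
Qed.

Lemma mwf_good D g G : mwf_sub D g G -> S_good D g G.
Proof. apply S_wf_good. Qed.

Lemma S_meq_ty G A B : meq_ty G A B -> S_ty G A = S_ty G B.
Proof. intros H; now apply S_wf_good in H. Qed.

Lemma S_meq_sub D g h G : meq_sub D g h G -> S_sub D g G = S_sub D h G.
Proof. apply S_wf_good. Qed.

Lemma S_subst :
  (forall G, mwf_ctx G -> True) /\
  (forall G A, mwf_ty G A -> forall D g, mwf_sub D g G ->
     S_ty D (mty_sub A g) = ty_sub (S_ty G A) (S_sub D g G)) /\
  (forall G t A, mwf_tm G t A -> forall D g, mwf_sub D g G ->
     S_tm D (mtm_sub t g) = tm_sub (S_tm G t) (S_sub D g G)) /\
  (forall D g G, mwf_sub D g G -> forall E h, mwf_sub E h D ->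
     S_sub E (msub_comp g h) G = sub_comp (S_sub D g G) (S_sub E h D)) /\
  (forall G A B, meq_ty G A B -> True) /\
  (forall G t u A, meq_tm G t u A -> True) /\
  (forall D g h G, meq_sub D g h G -> True).
Proof.
  apply mwf_mind; simpl; auto.
  - intros G A t u _ IHA _ IHt _ IHu D g Hg; now rewrite IHA, IHt, IHu.
  - intros G x A HG _ Hx D g Hg; apply S_lookup; eauto using mwf_good, in_mctx_dom.
  - intros G HG _ D g Hg; now rewrite S_lookup_bullet.
  - intros D k G A g HG HA Hg IH E h Hh; f_equal.
    rewrite sub_comp_assoc, IH; auto.
    apply collapse_vars_dom, mwf_good, Hg.
  - intros D HD _ E h Hh; now rewrite S_lookup_bullet.
  - intros D g t G x A Hg IHg HG _ Ht IHt E h Hh.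
    destruct (is_one A); simpl; auto; now rewrite IHg, IHt.
Qed.

Lemma is_one_D A : is_one (D_ty A) = is_star A.
Proof. destruct A; auto. Qed.

Lemma lookup_collapse G x A : wf_ctx G -> in_ctx x A G ->
  lookup (collapse G) x = Var (if is_star A then bullet else S x).
Proof.
  intros HG; revert x A; induction HG as [|G y B HG IH HB Hy]; simpl; [easy|].
  intros x A [[-> ->]|Hx]; [now rewrite Nat.eqb_refl|].
  destruct (Nat.eqb_spec x y); subst; auto.
  now apply in_ctx_dom in Hx.
Qed.

Lemma S_D :
  (forall G, wf_ctx G -> True) /\
  (forall G A, wf_ty G A -> S_ty (D_ctx G) (D_ty A) = ty_sub A (collapse G)) /\
  (forall G t A, wf_tm G t A -> S_tm (D_ctx G) (D_tm t) = tm_sub t (collapse G)) /\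
  (forall D g G, wf_sub D g G ->
     sub_comp (collapse G) (S_sub (D_ctx D) (D_sub g) (D_ctx G)) =
     sub_comp g (collapse D)) /\
  (forall k G A, valid k G A -> True).
Proof.
  apply wf_mind; simpl; auto.
  - intros G A t u _ IHA _ IHt _ IHu; congruence.
  - intros G x A HG _ Hx.
    rewrite (lookup_collapse HG Hx), (@has_type_one_in _ _ (D_ty A)), is_one_D;
      auto using D_in_ctx.
    now apply D_wf.
  - intros D k G A g HG _ _ Hg IH; now rewrite IH.
  - intros D g t G x A Hg IHg HG _ Ht IHt.
    rewrite is_one_D; destruct A as [|A v w]; simpl.
    + rewrite IHg, S_lookup_bullet, <- IHt.
      f_equal; symmetry.
      apply D_wf in Ht; eapply S_wf_good; eauto.
    + rewrite sub_comp_sext, IHg, Nat.eqb_refl, IHt; auto.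
      intros H; inversion HG; subst.
      destruct (collapse_vars H) as [?|(y & Hy & Hy')]; [easy|].
      injection Hy as <-; auto.
Qed.

Lemma S_ctx_bullet G : in_ctx bullet Star (S_ctx G).
Proof.
  induction G as [|G IH x A]; simpl; auto.
  destruct (is_one A); simpl; auto.
Qed.

Lemma S_fresh G x : ~ In x (mdom G) -> ~ In (S x) (dom (S_ctx G)).
Proof.
  intros H H'; destruct (S_ctx_dom H') as [?|(y & Hy & Hy')]; [easy|].
  injection Hy as <-; auto.
Qed.

Lemma wf_collapse G : wf_ctx G -> wf_sub (S_ctx (D_ctx G)) (collapse G) G.
Proof.
  induction 1 as [|G x A HG IH HA Hx]; simpl; [repeat constructor; auto|].
  assert (wf_ctx (cext G x A)) by (constructor; auto).
  pose proof (wf_sub_ctx IH).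
  rewrite is_one_D; destruct A as [|A t u]; simpl is_star.
  - constructor; auto; constructor; auto using S_ctx_bullet.
  - cbv iota.
    assert (E : S_ty (D_ctx G) (D_ty (Arr A t u)) = ty_sub (Arr A t u) (collapse G))
      by now apply S_D.
    rewrite E.
    assert (wf_ctx (cext (S_ctx (D_ctx G)) (S x) (ty_sub (Arr A t u) (collapse G)))).
    { constructor; auto.
      - eapply wf_subst; eauto.
      - apply S_fresh; now rewrite D_ctx_dom. }
    constructor; auto.
    + eapply wf_sub_weaken; eauto using sub_ctx_cext.
    + constructor; simpl; auto.
Qed.

Lemma S_in_ctx G x A : mwf_ctx G -> in_mctx x A G -> is_one A = false ->
  in_ctx (S x) (S_ty G A) (S_ctx G).
Proof.
  intros HG; revert x A; induction HG as [|G y B HG IH HB Hy]; simpl; [easy|].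
  intros x A [[-> ->]|Hx] HA.
  - rewrite HA, S_ty_cext; simpl; auto.
    intros H; apply Hy; revert H; now apply mwf_ty_scoped.
  - rewrite S_ty_cext.
    + destruct (is_one B); simpl; auto.
    + intros H; apply Hy; revert H; eapply in_mctx_scoped; eauto.
Qed.

Lemma S_wf :
  (forall G, mwf_ctx G -> wf_ctx (S_ctx G)) /\
  (forall G A, mwf_ty G A -> wf_ty (S_ctx G) (S_ty G A)) /\
  (forall G t A, mwf_tm G t A -> wf_tm (S_ctx G) (S_tm G t) (S_ty G A)) /\
  (forall D g G, mwf_sub D g G -> wf_sub (S_ctx D) (S_sub D g G) (S_ctx G)) /\
  (forall G A B, meq_ty G A B -> True) /\
  (forall G t u A, meq_tm G t u A -> True) /\
  (forall D g h G, meq_sub D g h G -> True).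
Proof.
  apply mwf_mind; simpl; auto.
  - repeat constructor; auto.
  - intros G x A _ HG _ HA Hx.
    destruct (is_one A); auto; constructor; auto using S_fresh.
  - intros; constructor; auto.
  - intros; constructor; auto.
  - intros G x A HG HSG Hx.
    rewrite (has_type_one_in HG Hx); destruct (is_one A) eqn:E.
    + apply is_one_spec in E; subst; constructor; auto using S_ctx_bullet.
    + constructor; auto using S_in_ctx.
  - intros; constructor; auto using S_ctx_bullet.
  - intros D k G A g HG HA Hg IH.
    assert (HA' : wf_ty G A) by eauto using valid_wf.
    assert (E : S_ty D (mty_sub (D_ty A) g) =
      ty_sub A (sub_comp (collapse G) (S_sub D g (D_ctx G)))).
    { rewrite (proj1 (proj2 S_subst) (D_ctx G)); auto.
      - rewrite (proj1 (proj2 S_D)); auto.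
        apply ty_sub_sub.
        rewrite (wf_sub_dom (wf_collapse (ps_wf HG))); now apply wf_ty_scoped.
      - now apply D_wf. }
    rewrite E; constructor; auto.
    eapply wf_subst; eauto using wf_collapse, ps_wf.
  - intros G t A B _ IH HAB _; now rewrite <- (S_meq_ty HAB).
  - intros D _ HD; repeat constructor; simpl; auto.
    apply S_ctx_bullet.
  - intros D g t G x A Hg IHg HG IHG Ht IHt.
    destruct (is_one A); auto; constructor; auto.
    rewrite <- (proj1 (proj2 S_subst) G); auto.
    now inversion HG.
Qed.

Lemma S_sub_id G : mwf_ctx G -> S_sub G (msub_id G) G = sub_id (S_ctx G).
Proof.
  induction 1 as [|G x A HG IH HA Hx]; simpl; auto.
  assert (Hv : ~ In x (msub_vars (msub_id G))).
  { intros H; apply Hx; revert H; apply mwf_sub_scoped with G; now apply mwf_sub_id. }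
  rewrite S_sub_cext, IH; auto.
  rewrite Nat.eqb_refl; destruct (is_one A); auto.
Qed.

Definition fresh (l : list nat) : nat := S (list_max l).

Lemma fresh_spec l : ~ In (fresh l) l.
Proof.
  intros H; unfold fresh in H.
  assert (F : Forall (fun k => k <= list_max l) l) by (apply list_max_le; auto).
  rewrite Forall_forall in F; apply F in H; lia.
Qed.

Lemma wf_ty_subst D g G A : wf_sub D g G -> wf_ty G A -> wf_ty D (ty_sub A g).
Proof. intros; eapply wf_subst; eauto. Qed.

Lemma wf_tm_subst D g G t A : wf_sub D g G -> wf_tm G t A /\ wf_ty G A ->
  wf_tm D (tm_sub t g) (ty_sub A g) /\ wf_ty D (ty_sub A g).
Proof. intros ? []; split; eapply wf_subst; eauto. Qed.

Lemma wf_sub_comp E D G g h :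
  wf_sub D g G -> wf_sub E h D -> wf_sub E (sub_comp g h) G.
Proof. intros; eapply wf_subst; eauto. Qed.

Lemma mwf_ty_subst D g G A : mwf_sub D g G -> mwf_ty G A -> mwf_ty D (mty_sub A g).
Proof. intros; eapply mwf_subst; eauto. Qed.

Lemma mwf_tm_subst D g G t A : mwf_sub D g G -> mwf_tm G t A /\ mwf_ty G A ->
  mwf_tm D (mtm_sub t g) (mty_sub A g) /\ mwf_ty D (mty_sub A g).
Proof. intros ? []; split; eapply mwf_subst; eauto. Qed.

Lemma mwf_sub_comp E D G g h :
  mwf_sub D g G -> mwf_sub E h D -> mwf_sub E (msub_comp g h) G.
Proof. intros; eapply mwf_subst; eauto. Qed.

Definition Syn_CaTT_cat : Category.
Proof.
  refine {|
    Ob := {G : ctx | wf_ctx G};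
    Hom := fun D G => {g : sub | wf_sub (proj1_sig D) g (proj1_sig G)};
    hom_eq := fun D G g h => proj1_sig g = proj1_sig h;
    idm := fun G => exist _ (sub_id (proj1_sig G)) (wf_sub_id (proj2_sig G));
    comp := fun E D G g h => exist _ (sub_comp (proj1_sig g) (proj1_sig h))
      (wf_sub_comp (proj2_sig g) (proj2_sig h)) |}.
  - intros D G; split; [intros g; reflexivity|intros g h; apply eq_sym|].
    intros g h k; apply eq_trans.
  - simpl; intros; congruence.
  - intros D G [g Hg]; simpl; eapply sub_comp_idl; eauto.
  - intros D G [g Hg]; apply sub_comp_idr.
  - intros F E D G [g Hg] [h Hh] [k Hk]; simpl.
    symmetry; apply sub_comp_assoc.
    rewrite (wf_sub_dom Hh); now apply wf_sub_scoped in Hg.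
Defined.

Definition Syn_MCaTT_cat : Category.
Proof.
  refine {|
    Ob := {G : mctx | mwf_ctx G};
    Hom := fun D G => {g : msub | mwf_sub (proj1_sig D) g (proj1_sig G)};
    hom_eq := fun D G g h =>
      meq_sub (proj1_sig D) (proj1_sig g) (proj1_sig h) (proj1_sig G);
    idm := fun G => exist _ (msub_id (proj1_sig G)) (mwf_sub_id (proj2_sig G));
    comp := fun E D G g h => exist _ (msub_comp (proj1_sig g) (proj1_sig h))
      (mwf_sub_comp (proj2_sig g) (proj2_sig h)) |}.
  - intros D G; split.
    + intros [g Hg]; now apply meq_sub_refl.
    + intros [g Hg] [h Hh]; now apply meq_sub_sym.
    + intros [g Hg] [h Hh] [k Hk]; now apply meq_sub_trans.
  - intros E D G [g Hg] [g' Hg'] [h Hh] [h' Hh']; simpl; intros H K.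
    apply meq_sub_trans with (msub_comp g' h).
    + eapply mwf_subst; eauto.
    + eapply mwf_subst; eauto.
    + eapply mwf_functional; eauto.
  - intros D G [g Hg]; simpl; rewrite (msub_comp_idl Hg); now apply meq_sub_refl.
  - intros D G [g Hg]; simpl; rewrite msub_comp_idr; now apply meq_sub_refl.
  - intros F E D G [g Hg] [h Hh] [k Hk]; simpl.
    rewrite msub_comp_assoc.
    + apply meq_sub_refl; eapply mwf_subst; eauto; eapply mwf_subst; eauto.
    + rewrite (mwf_sub_dom Hh); now apply mwf_sub_scoped in Hg.
Defined.

Definition nil_obj : Syn_CaTT_cat := exist _ cnil wf_cnil.

Definition mnil_obj : Syn_MCaTT_cat := exist _ mcnil mwf_cnil.

Lemma nil_terminal : is_terminal nil_obj.
Proof.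
  intros [G HG]; exists (exist _ snil (wf_snil HG)); intros [g Hg]; simpl in *.
  now inversion Hg.
Qed.

Lemma mnil_terminal : is_terminal mnil_obj.
Proof.
  intros [G HG]; exists (exist _ msnil (mwf_snil HG)); intros [g Hg]; simpl in *.
  inversion Hg; now constructor.
Qed.

Lemma wf_ext_fresh G A : wf_ty G A -> wf_ctx (cext G (fresh (dom G)) A).
Proof. intros H; constructor; auto using fresh_spec; eapply wf_ty_ctx; eauto. Qed.

Lemma mwf_ext_fresh G A : mwf_ty G A -> mwf_ctx (mcext G (fresh (mdom G)) A).
Proof. intros H; constructor; auto using fresh_spec; eapply mwf_ty_ctx; eauto. Qed.

Lemma wf_gen G A : wf_ty G A ->
  wf_tm (cext G (fresh (dom G)) A) (Var (fresh (dom G))) A /\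
  wf_ty (cext G (fresh (dom G)) A) A.
Proof.
  intros HA; pose proof (wf_ext_fresh HA); split.
  - constructor; simpl; auto.
  - eapply wf_sub_weaken; eauto using sub_ctx_cext.
Qed.

Lemma mwf_gen G A : mwf_ty G A ->
  mwf_tm (mcext G (fresh (mdom G)) A) (MVar (fresh (mdom G))) A /\
  mwf_ty (mcext G (fresh (mdom G)) A) A.
Proof.
  intros HA; pose proof (mwf_ext_fresh HA); split.
  - constructor; simpl; auto.
  - eapply mwf_weaken; eauto using sub_mctx_cext.
Qed.

(** The comprehension of [A] extends the context with a fresh variable of type
    [A]; any other choice of name gives an isomorphic context. *)
Definition Syn_CaTT : CwF.
Proof.
  refine {|
    base := Syn_CaTT_cat;
    empty_ctx := nil_obj;
    empty_terminal := nil_terminal;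
    Ty := fun G : Syn_CaTT_cat => {A : ty | wf_ty (proj1_sig G) A};
    ty_eq := fun G A B => proj1_sig A = proj1_sig B;
    ty_act := fun D G g A => exist _ (ty_sub (proj1_sig A) (proj1_sig g))
      (wf_ty_subst (proj2_sig g) (proj2_sig A));
    Tm := fun G : Syn_CaTT_cat =>
      {p : tm * ty | wf_tm (proj1_sig G) (fst p) (snd p) /\
                     wf_ty (proj1_sig G) (snd p)};
    tm_eq := fun G t u => proj1_sig t = proj1_sig u;
    tm_act := fun D G g t =>
      exist _ (tm_sub (fst (proj1_sig t)) (proj1_sig g),
               ty_sub (snd (proj1_sig t)) (proj1_sig g))
        (wf_tm_subst (proj2_sig g) (proj2_sig t));
    ty_of := fun G t => exist _ (snd (proj1_sig t)) (proj2 (proj2_sig t));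
    ext := fun G A =>
      exist _ (cext (proj1_sig G) (fresh (dom (proj1_sig G))) (proj1_sig A))
        (wf_ext_fresh (proj2_sig A));
    disp := fun G A => exist _ (sub_id (proj1_sig G))
      (wf_sub_wk (wf_ext_fresh (proj2_sig A)));
    gen := fun G A => exist _ (Var (fresh (dom (proj1_sig G))), proj1_sig A)
      (wf_gen (proj2_sig A)) |}.
  - intros G; split; [intros A; reflexivity|intros A B; apply eq_sym|].
    intros A B C; apply eq_trans.
  - simpl; intros; congruence.
  - intros G A; apply ty_sub_id.
  - intros E D G [g Hg] [h Hh] [A HA]; simpl; symmetry; apply ty_sub_sub.
    rewrite (wf_sub_dom Hg); now apply wf_ty_scoped.
  - intros G; split; [intros t; reflexivity|intros t u; apply eq_sym|].
    intros t u v; apply eq_trans.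
  - simpl; intros; congruence.
  - intros G [[t A] Ht]; simpl; now rewrite ty_sub_id, tm_sub_id.
  - intros E D G [g Hg] [h Hh] [[t A] [Ht HA]]; simpl in *.
    rewrite ty_sub_sub, tm_sub_sub; auto; rewrite (wf_sub_dom Hg).
    + now apply wf_tm_scoped in Ht.
    + now apply wf_ty_scoped.
  - simpl; intros; congruence.
  - reflexivity.
  - intros G A; simpl; now rewrite ty_sub_id.
  - intros [D HD] [G HG] [A HA] [g Hg] [[t B] [Ht HB]] E; simpl in *; subst B.
    exists (exist _ (sext g (fresh (dom G)) t) (wf_sext Hg (wf_ext_fresh HA) Ht)).
    simpl; rewrite Nat.eqb_refl; repeat split.
    + rewrite sub_comp_wk; [eapply sub_comp_idl; eauto|apply fresh_spec].
    + f_equal; apply ty_sub_sext.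
      intros H; apply (fresh_spec (l := dom G)), (wf_ty_scoped HA), H.
    + intros [m Hm]; inversion Hm; subst; simpl; intros E1 E2.
      rewrite Nat.eqb_refl in E2; injection E2 as E2 _.
      rewrite sub_comp_wk in E1 by apply fresh_spec.
      erewrite sub_comp_idl in E1 by eauto; congruence.
Defined.

Definition Syn_MCaTT : CwF.
Proof.
  refine {|
    base := Syn_MCaTT_cat;
    empty_ctx := mnil_obj;
    empty_terminal := mnil_terminal;
    Ty := fun G : Syn_MCaTT_cat => {A : mty | mwf_ty (proj1_sig G) A};
    ty_eq := fun G A B => meq_ty (proj1_sig G) (proj1_sig A) (proj1_sig B);
    ty_act := fun D G g A => exist _ (mty_sub (proj1_sig A) (proj1_sig g))
      (mwf_ty_subst (proj2_sig g) (proj2_sig A));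
    Tm := fun G : Syn_MCaTT_cat =>
      {p : mtm * mty | mwf_tm (proj1_sig G) (fst p) (snd p) /\
                       mwf_ty (proj1_sig G) (snd p)};
    tm_eq := fun G t u =>
      meq_ty (proj1_sig G) (snd (proj1_sig t)) (snd (proj1_sig u)) /\
      meq_tm (proj1_sig G) (fst (proj1_sig t)) (fst (proj1_sig u)) (snd (proj1_sig t));
    tm_act := fun D G g t =>
      exist _ (mtm_sub (fst (proj1_sig t)) (proj1_sig g),
               mty_sub (snd (proj1_sig t)) (proj1_sig g))
        (mwf_tm_subst (proj2_sig g) (proj2_sig t));
    ty_of := fun G t => exist _ (snd (proj1_sig t)) (proj2 (proj2_sig t));
    ext := fun G A =>
      exist _ (mcext (proj1_sig G) (fresh (mdom (proj1_sig G))) (proj1_sig A))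
        (mwf_ext_fresh (proj2_sig A));
    disp := fun G A => exist _ (msub_id (proj1_sig G))
      (mwf_sub_wk (mwf_ext_fresh (proj2_sig A)));
    gen := fun G A => exist _ (MVar (fresh (mdom (proj1_sig G))), proj1_sig A)
      (mwf_gen (proj2_sig A)) |}.
  - intros G; split.
    + intros [A HA]; now apply meq_ty_refl.
    + intros A B; apply meq_ty_sym.
    + intros A B C; apply meq_ty_trans.
  - intros D G [g Hg] [g' Hg'] [A HA] [A' HA']; simpl; intros H K.
    eapply meq_ty_trans.
    + eapply mwf_subst; eauto.
    + eapply meq_ty_functional; eauto.
  - intros G [A HA]; simpl; rewrite mty_sub_id; now apply meq_ty_refl.
  - intros E D G [g Hg] [h Hh] [A HA]; simpl.
    rewrite mty_sub_sub.
    + apply meq_ty_refl; eapply mwf_subst; eauto; eapply mwf_subst; eauto.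
    + rewrite (mwf_sub_dom Hg); now apply mwf_ty_scoped.
  - intros G; split.
    + intros [[t A] [Ht HA]]; split; [now apply meq_ty_refl|now apply meq_tm_refl].
    + intros [[t A] Ht] [[u B] Hu] [H K]; simpl in *; split; [now apply meq_ty_sym|].
      eapply meq_conv; [apply meq_tm_sym|]; eauto.
    + intros [[t A] Ht] [[u B] Hu] [[v C] Hv] [H K] [H' K']; simpl in *; split.
      * eapply meq_ty_trans; eauto.
      * eapply meq_tm_trans; eauto.
        eapply meq_conv; eauto; now apply meq_ty_sym.
  - intros D G [g Hg] [g' Hg'] [[t A] [Ht HA]] [[u B] [Hu HB]]; simpl in *.
    intros H [K L]; split.
    + eapply meq_ty_trans; [eapply mwf_subst; eauto|eapply meq_ty_functional; eauto].
    + eapply meq_tm_trans; [eapply mwf_subst; eauto|].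
      eapply mwf_functional; eauto.
      eapply mwf_conv; eauto; now apply meq_ty_sym.
  - intros G [[t A] [Ht HA]]; simpl in *; rewrite mty_sub_id, mtm_sub_id.
    split; [now apply meq_ty_refl|now apply meq_tm_refl].
  - intros E D G [g Hg] [h Hh] [[t A] [Ht HA]]; simpl in *.
    rewrite mty_sub_sub, mtm_sub_sub; try rewrite (mwf_sub_dom Hg).
    + assert (Hgh : mwf_sub (proj1_sig E) (msub_comp g h) (proj1_sig G))
        by (eapply mwf_subst; eauto).
      split; [apply meq_ty_refl|apply meq_tm_refl]; eapply mwf_subst; eauto.
    + now apply mwf_tm_scoped in Ht.
    + now apply mwf_ty_scoped.
  - intros G [[t A] Ht] [[u B] Hu] [H K]; exact H.
  - intros D G [g Hg] [[t A] [Ht HA]]; simpl in *.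
    apply meq_ty_refl; eapply mwf_subst; eauto.
  - intros G [A HA]; simpl; rewrite mty_sub_id.
    apply meq_ty_refl; eapply mwf_weaken; eauto using mwf_ext_fresh, sub_mctx_cext.
  - intros [D HD] [G HG] [A HA] [g Hg] [[t B] [Ht HB]] E; simpl in *.
    pose proof (mwf_ext_fresh HA) as HGA.
    exists (exist _ (msext g (fresh (mdom G)) t) (mwf_sext Hg HGA (mwf_conv Ht E))).
    simpl; rewrite Nat.eqb_refl.
    rewrite msub_comp_wk, (msub_comp_idl Hg) by apply fresh_spec.
    rewrite mty_sub_sext
      by (intros H; apply (fresh_spec (l := mdom G)), (mwf_ty_scoped HA), H).
    split; [split; [now apply meq_sub_refl|split]|].
    + now apply meq_ty_sym.
    + apply meq_tm_refl; eapply mwf_conv; eauto.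
    + intros [m Hm]; simpl; intros E1 [E2 E3]; inversion Hm; subst; simpl in *.
      rewrite Nat.eqb_refl in E3.
      rewrite msub_comp_wk in E1 by apply fresh_spec.
      erewrite msub_comp_idl in E1 by eauto.
      constructor; auto.
      rewrite mty_sub_sext in E3
        by (intros H; apply (fresh_spec (l := mdom G)), (mwf_ty_scoped HA), H).
      exact E3.
Defined.

Lemma D_wf_ctx G : wf_ctx G -> mwf_ctx (D_ctx G).
Proof. apply D_wf. Qed.

Lemma D_wf_sub D g G : wf_sub D g G -> mwf_sub (D_ctx D) (D_sub g) (D_ctx G).
Proof. apply D_wf. Qed.

Lemma S_wf_ctx G : mwf_ctx G -> wf_ctx (S_ctx G).
Proof. apply S_wf. Qed.

Lemma S_wf_sub D g G : mwf_sub D g G -> wf_sub (S_ctx D) (S_sub D g G) (S_ctx G).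
Proof. apply S_wf. Qed.

Definition Desuspension : Functor Syn_CaTT Syn_MCaTT.
Proof.
  refine (@Build_Functor Syn_CaTT_cat Syn_MCaTT_cat
    (fun G => exist _ (D_ctx (proj1_sig G)) (D_wf_ctx (proj2_sig G)))
    (fun D G g => exist _ (D_sub (proj1_sig g)) (D_wf_sub (proj2_sig g))) _ _ _).
  - intros D G [g Hg] [h Hh]; simpl; intros <-.
    apply meq_sub_refl; now apply D_wf.
  - intros [G HG]; simpl; rewrite D_sub_id.
    apply meq_sub_refl, mwf_sub_id; now apply D_wf.
  - intros E D G [g Hg] [h Hh]; simpl; rewrite <- (proj2 (D_subst h)).
    apply meq_sub_refl; apply D_wf; eapply wf_subst; eauto.
Defined.

Definition ReducedSuspension : Functor Syn_MCaTT Syn_CaTT.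
Proof.
  refine (@Build_Functor Syn_MCaTT_cat Syn_CaTT_cat
    (fun G => exist _ (S_ctx (proj1_sig G)) (S_wf_ctx (proj2_sig G)))
    (fun D G g => exist _ (S_sub (proj1_sig D) (proj1_sig g) (proj1_sig G))
                         (S_wf_sub (proj2_sig g))) _ _ _).
  - intros D G [g Hg] [h Hh]; apply S_meq_sub.
  - intros [G HG]; now apply S_sub_id.
  - intros E D G [g Hg] [h Hh]; simpl; eapply S_subst; eauto.
Defined.

Lemma D0_wf : wf_ctx (cext cnil 0 Star).
Proof. repeat constructor; simpl; auto. Qed.

Definition D0 : Syn_CaTT := exist _ (cext cnil 0 Star) D0_wf.

Definition underlying (C : CwF) : Functor (Mod C) (FunCat C SET) :=
  incl_full (C := FunCat C SET) (@is_model C).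

Definition singleton_at_D0 (F : Mod Syn_CaTT) : Prop :=
  is_singleton (fob (underlying Syn_CaTT F : Functor Syn_CaTT SET) D0).

Definition Mod_CaTT_D0 : Category := FullSub singleton_at_D0.

(** F ↦ F ∘ D and F ↦ F ∘ Σ_r, before it is known that they land in models. *)

Definition precomp_D : Functor (Mod Syn_MCaTT) (FunCat Syn_CaTT SET) :=
  FunComp (precomp SET Desuspension) (underlying Syn_MCaTT).

Definition precomp_S : Functor Mod_CaTT_D0 (FunCat Syn_MCaTT SET) :=
  FunComp (precomp SET ReducedSuspension)
    (FunComp (underlying Syn_CaTT) (incl_full singleton_at_D0)).

(* Main.v *)
(** The substitutions [collapse G] : Σ_r D G → G are natural in CaTT, and so are
    the substitutions [counit G] : D Σ_r G → G in MCaTT.  Every model of MCaTT,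
    and every model of CaTT with a singleton value at D⁰, inverts them.  This
    goes by induction on the context: extending [G] by a variable of type ⋆ in
    CaTT, or of type 1 in MCaTT, leaves the source of the component unchanged and
    changes the value of the model at [G] only by a bijection; extending it by an
    arrow type makes the new component a pullback of the previous one along a
    display map. *)

From Stdlib Require Import List PeanoNat Setoid Morphisms IndefiniteDescription.
Require Import Defs.

Set Implicit Arguments.
Unset Strict Implicit.
Unset Printing Implicit Defensive.

(** * Setoid rewriting, isomorphisms and terminal objects *)

#[local] Instance comp_proper (C : Category) (a b c : C) :
  Proper (@hom_eq C b c ==> @hom_eq C a b ==> @hom_eq C a c) (@comp C a b c).
Proof. intros g g' Hg f f' Hf; now apply comp_ext. Qed.

#[local] Instance fmap_proper (C D : Category) (F : Functor C D) (a b : C) :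
  Proper (@hom_eq C a b ==> @hom_eq D (F a) (F b)) (@fmap C D F a b).
Proof. intros f f' Hf; now apply fmap_ext. Qed.

Definition is_iso (C : Category) (a b : C) (f : Hom a b) : Prop :=
  exists g : Hom b a, g ∘ f ≈ idm a /\ f ∘ g ≈ idm b.

Lemma is_iso_ext (C : Category) (a b : C) (f g : Hom a b) :
  f ≈ g -> is_iso f -> is_iso g.
Proof. intros E [h [H1 H2]]; exists h; now rewrite <- E. Qed.

Lemma is_iso_fmap (C D : Category) (F : Functor C D) (a b : C) (f : Hom a b) :
  is_iso f -> is_iso (fmap F f).
Proof.
  intros [g [H1 H2]]; exists (fmap F g).
  now rewrite <- !fmap_comp, H1, H2, !fmap_id.
Qed.

Lemma is_iso_comp (C : Category) (a b c : C) (g : Hom b c) (f : Hom a b) :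
  is_iso g -> is_iso f -> is_iso (g ∘ f).
Proof.
  intros [g' [G1 G2]] [f' [F1 F2]]; exists (f' ∘ g'); split.
  - now rewrite <- comp_assoc, (comp_assoc g'), G1, comp_idl.
  - now rewrite <- comp_assoc, (comp_assoc f), F2, comp_idl.
Qed.

Lemma is_iso_cancel (C : Category) (a b c : C) (g : Hom b c) (f : Hom a b) :
  is_iso g -> is_iso (g ∘ f) -> is_iso f.
Proof.
  intros [g' [H1 H2]] [k [K1 K2]]; exists (k ∘ g); split.
  - now rewrite <- comp_assoc.
  - rewrite <- (comp_idl (f ∘ (k ∘ g))), <- H1.
    rewrite !comp_assoc, <- (comp_assoc g' g f), <- (comp_assoc g' (g ∘ f) k), K2.
    now rewrite comp_idr.
Qed.

Lemma terminal_maps_eq (C : Category) (t x : C) (f g : Hom x t) :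
  is_terminal t -> f ≈ g.
Proof. intros H; destruct (H x) as [h Hh]; now rewrite (Hh f), (Hh g). Qed.

Lemma is_iso_terminal (C : Category) (a b : C) (f : Hom a b) :
  is_terminal a -> is_terminal b -> is_iso f.
Proof.
  intros Ha Hb; destruct (Ha b) as [g _]; exists g.
  split; now apply terminal_maps_eq.
Qed.

Lemma terminal_iso (C : Category) (a b : C) (f : Hom a b) :
  is_iso f -> is_terminal a -> is_terminal b.
Proof.
  intros [g [_ H]] Ha x; destruct (Ha x) as [h _]; exists (f ∘ h); intros k.
  rewrite <- (comp_idl k), <- H, <- comp_assoc.
  now rewrite (terminal_maps_eq (g ∘ k) h Ha).
Qed.

(** Terminal objects are isomorphic, so preservation of the chosen empty context, as in [is_model],
    extends to every terminal object. *)
Lemma fmap_terminal (C D : Category) (F : Functor C D) (t t' : C) :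
  is_terminal t -> is_terminal t' -> is_terminal (F t) -> is_terminal (F t').
Proof.
  intros Ht Ht'; destruct (Ht' t) as [f _].
  apply (terminal_iso (is_iso_fmap F (is_iso_terminal f Ht Ht'))).
Qed.

Lemma is_singleton_terminal (X : SET) : is_singleton X <-> is_terminal X.
Proof.
  split.
  - intros [x Hx] Y; exists (fun _ => x); intros g y; apply Hx.
  - intros H; destruct (H unit) as [f Hf]; exists (f tt); intros y.
    exact (Hf (fun _ => y) tt).
Qed.

(** * Pullback squares and isomorphisms *)

Section Pullbacks.
Variable C : Category.

Lemma pullback_ext (p a b c : C) (u u' : Hom p a) (q q' : Hom p b)
    (f f' : Hom a c) (g g' : Hom b c) :
  u ≈ u' -> q ≈ q' -> f ≈ f' -> g ≈ g' ->
  is_pullback u q f g -> is_pullback u' q' f' g'.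
Proof.
  intros Eu Eq Ef Eg [H K]; split; [now rewrite <- Ef, <- Eg, <- Eu, <- Eq|].
  intros x h k E; rewrite <- Ef, <- Eg in E.
  destruct (K x h k E) as [m [[H1 H2] H3]]; exists m.
  rewrite <- Eu, <- Eq; split; auto.
  intros m'; rewrite <- Eu, <- Eq; apply H3.
Qed.

Lemma pullback_sym (p a b c : C) (u : Hom p a) (q : Hom p b) (f : Hom a c) (g : Hom b c) :
  is_pullback u q f g -> is_pullback q u g f.
Proof.
  intros [H K]; split; [now symmetry|].
  intros x h k E; symmetry in E.
  destruct (K x k h E) as [m [[H1 H2] H3]]; exists m; auto.
Qed.

Lemma pullback_map_ext (p a b c x : C) (u : Hom p a) (q : Hom p b)
    (f : Hom a c) (g : Hom b c) (m m' : Hom x p) :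
  is_pullback u q f g -> u ∘ m ≈ u ∘ m' -> q ∘ m ≈ q ∘ m' -> m ≈ m'.
Proof.
  intros [H K] Eu Eq.
  destruct (K x (u ∘ m') (q ∘ m')) as [n [_ Hn]].
  - now rewrite !comp_assoc, H.
  - rewrite (Hn m), (Hn m'); easy.
Qed.

Lemma is_iso_pullback (p a b c : C) (u : Hom p a) (q : Hom p b)
    (f : Hom a c) (g : Hom b c) :
  is_pullback u q f g -> is_iso g -> is_iso u.
Proof.
  intros HP [g' [H1 H2]].
  (* The inverse is the section of [u] induced by the cone [idm a], [g' ∘ f]. *)
  destruct (proj2 HP a (idm a) (g' ∘ f)) as [m [[Hm Hm'] _]].
  - now rewrite comp_idr, comp_assoc, H2, comp_idl.
  - exists m; split; auto.
    apply (pullback_map_ext HP).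
    + now rewrite comp_assoc, Hm, comp_idl, comp_idr.
    + rewrite comp_assoc, Hm', comp_idr, <- comp_assoc, (proj1 HP).
      now rewrite comp_assoc, H1, comp_idl.
Qed.

Lemma pullback_iso (p a b c : C) (u : Hom p a) (q : Hom p b)
    (f : Hom a c) (g : Hom b c) :
  f ∘ u ≈ g ∘ q -> is_iso u -> is_iso g -> is_pullback u q f g.
Proof.
  intros H [u' [U1 U2]] [g' [G1 G2]]; split; auto.
  intros x h k E; exists (u' ∘ h); repeat split.
  - now rewrite comp_assoc, U2, comp_idl.
  - rewrite <- (comp_idl (q ∘ _)), <- G1, <- comp_assoc, (comp_assoc g q), <- H.
    rewrite <- comp_assoc, (comp_assoc u), U2, comp_idl, E.
    now rewrite comp_assoc, G1, comp_idl.
  - intros m Hm _; now rewrite <- Hm, comp_assoc, U1, comp_idl.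
Qed.

Lemma pullback_precomp_iso (p' p a b c : C) (i : Hom p' p) (u : Hom p a) (q : Hom p b)
    (f : Hom a c) (g : Hom b c) :
  is_iso i -> is_pullback u q f g -> is_pullback (u ∘ i) (q ∘ i) f g.
Proof.
  intros [j [J1 J2]] [H K]; split; [now rewrite !comp_assoc, H|].
  intros x h k E; destruct (K x h k E) as [m [[H1 H2] H3]]; exists (j ∘ m).
  rewrite <- !comp_assoc, (comp_assoc i), J2, comp_idl; split; auto.
  intros m'; rewrite <- !comp_assoc; intros E1 E2.
  now rewrite <- (H3 (i ∘ m')), comp_assoc, J1, comp_idl.
Qed.

Lemma pullback_unique (p p' a b c : C) (u : Hom p a) (q : Hom p b)
    (u' : Hom p' a) (q' : Hom p' b) (f : Hom a c) (g : Hom b c) :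
  is_pullback u q f g -> is_pullback u' q' f g ->
  exists i : Hom p' p, is_iso i /\ u ∘ i ≈ u' /\ q ∘ i ≈ q'.
Proof.
  intros HP HP'.
  destruct (proj2 HP p' u' q' (proj1 HP')) as [i [[I1 I2] _]].
  destruct (proj2 HP' p u q (proj1 HP)) as [j [[J1 J2] _]].
  exists i; repeat split; auto; exists j; split.
  - apply (pullback_map_ext HP'); rewrite comp_assoc, ?J1, ?J2, comp_idr; auto.
  - apply (pullback_map_ext HP); rewrite comp_assoc, ?I1, ?I2, comp_idr; auto.
Qed.

Lemma pullback_postcomp_iso (p a b b' c : C) (u : Hom p a) (q : Hom p b)
    (f : Hom a c) (e : Hom b b') (g : Hom b' c) :
  is_iso e -> is_pullback u (e ∘ q) f g <-> is_pullback u q f (g ∘ e).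
Proof.
  intros [e' [E1 E2]]; split; intros [H K]; split.
  - now rewrite <- comp_assoc.
  - intros x h k E; rewrite <- comp_assoc in E.
    destruct (K x h (e ∘ k) E) as [m [[H1 H2] H3]]; exists m; repeat split; auto.
    + rewrite <- (comp_idl (q ∘ m)), <- (comp_idl k), <- E1.
      now rewrite <- (comp_assoc _ _ k), <- H2, !comp_assoc.
    + intros m' M1 M2; apply H3; auto; now rewrite <- comp_assoc, M2.
  - now rewrite comp_assoc.
  - intros x h k E.
    destruct (K x h (e' ∘ k)) as [m [[H1 H2] H3]].
    { now rewrite <- comp_assoc, (comp_assoc e), E2, comp_idl. }
    exists m; repeat split; auto.
    + now rewrite <- comp_assoc, H2, comp_assoc, E2, comp_idl.
    + intros m' M1 M2; apply H3; auto.
      now rewrite <- M2, !comp_assoc, E1, comp_idl.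
Qed.

End Pullbacks.

(** * Functors preserving pullbacks along a given map *)

Definition preserves_pullbacks_along (C D : Category) (F : Functor C D) (b c : C)
    (f : Hom b c) : Prop :=
  forall (p a : C) (g : Hom a c) (u : Hom p a) (q : Hom p b),
    is_pullback u q g f -> is_pullback (fmap F u) (fmap F q) (fmap F g) (fmap F f).

(** A pullback of an isomorphism is an isomorphism, and a commuting square with isomorphisms on two
    opposite sides is a pullback; any functor keeps such a square. *)
Lemma preserves_iso (C D : Category) (F : Functor C D) (b c : C) (f : Hom b c) :
  is_iso f -> preserves_pullbacks_along F f.
Proof.
  intros Hf p a g u q HP; apply pullback_iso.
  - now rewrite <- !fmap_comp, (proj1 HP).
  - apply is_iso_fmap, (is_iso_pullback HP Hf).
  - now apply is_iso_fmap.
Qed.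

Lemma preserves_comp_iso (C D : Category) (F : Functor C D) (b b' c : C)
    (d : Hom b' c) (e : Hom b b') (f : Hom b c) :
  f ≈ d ∘ e -> is_iso e -> preserves_pullbacks_along F d -> preserves_pullbacks_along F f.
Proof.
  intros E He Hd p a g u q HP.
  assert (HP' : is_pullback u (e ∘ q) g d).
  { apply pullback_postcomp_iso; auto; revert HP; now apply pullback_ext. }
  apply Hd in HP'.
  apply pullback_ext with (fmap F u) (fmap F q) (fmap F g) (fmap F d ∘ fmap F e);
    try reflexivity.
  - now rewrite E, fmap_comp.
  - apply pullback_postcomp_iso; [now apply is_iso_fmap|].
    revert HP'; apply pullback_ext; try reflexivity; apply fmap_comp.
Qed.

(** Pullbacks being unique, it is enough to treat one pullback of each map. *)
Lemma preserves_chosen (C D : Category) (F : Functor C D) (b c : C) (f : Hom b c) :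
  (forall (a : C) (g : Hom a c), exists (p : C) (u : Hom p a) (q : Hom p b),
     is_pullback u q g f /\
     is_pullback (fmap F u) (fmap F q) (fmap F g) (fmap F f)) ->
  preserves_pullbacks_along F f.
Proof.
  intros H p a g u q HP; destruct (H a g) as (p0 & u0 & q0 & HP0 & HF).
  destruct (pullback_unique HP0 HP) as (i & Hi & Eu & Eq).
  apply (pullback_precomp_iso (is_iso_fmap F Hi)) in HF.
  revert HF; apply pullback_ext; try reflexivity; now rewrite <- fmap_comp, ?Eu, ?Eq.
Qed.

Lemma preserves_FunComp (C D E : Category) (F : Functor C D) (G : Functor D E) (b c : C)
    (f : Hom b c) :
  preserves_pullbacks_along F f -> preserves_pullbacks_along G (fmap F f) ->
  preserves_pullbacks_along (FunComp G F) f.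
Proof. intros HF HG p a g u q HP; now apply HG, HF. Qed.

(** [is_iso] only asserts that inverses exist, while a natural transformation carries data, so the
    pointwise inverses are picked by indefinite description; their naturality is automatic. *)
Lemma nat_iso (C D : Category) (F G : Functor C D) (r : NatTrans F G) :
  (forall a, is_iso (r a)) -> is_iso (C := FunCat C D) r.
Proof.
  intros H.
  set (s a := proj1_sig (constructive_indefinite_description _ (H a))).
  assert (Hs : forall a, s a ∘ r a ≈ idm (F a) /\ r a ∘ s a ≈ idm (G a)).
  { intros a; unfold s; apply proj2_sig. }
  assert (N : forall a b (f : Hom a b), s b ∘ fmap G f ≈ fmap F f ∘ s a).
  { intros a b f; destruct (Hs a) as [_ Ha], (Hs b) as [Hb _].
    rewrite <- (comp_idr (fmap G f)), <- Ha, (comp_assoc (fmap G f)), <- nt_nat.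
    now rewrite !comp_assoc, Hb, comp_idl. }
  exists {| nt_app := s; nt_nat := N |}; split; intros a; apply Hs.
Qed.

(** * Weakenings and their pullbacks in CaTT *)

Lemma wf_sub_lift D g G x y A :
  wf_sub D g G -> wf_ctx (cext G x A) -> wf_ctx (cext D y (ty_sub A g)) ->
  wf_sub (cext D y (ty_sub A g)) (sext g x (Var y)) (cext G x A).
Proof.
  intros Hg HG HD; constructor; auto.
  - eapply wf_sub_weaken; eauto using sub_ctx_cext.
  - constructor; simpl; auto.
Qed.

Definition obj G (HG : wf_ctx G) : Syn_CaTT := exist _ G HG.

Definition mor (D G : Syn_CaTT) (g : sub) (H : wf_sub (proj1_sig D) g (proj1_sig G)) :
  Hom D G := exist _ g H.

(** A substitution into [P] is a substitution [h] into [D] with a term of type [A] acted on by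
    [g ∘ h], that is, a cone over [g] and [d]. The hypotheses bear on raw syntax, so any variable
    names and typing derivations may occur. *)
Lemma pullback_lift (D G P E : Syn_CaTT) (x y : nat) (A : ty)
    (g : Hom D G) (u : Hom P D) (q : Hom P E) (d : Hom E G) :
  proj1_sig E = cext (proj1_sig G) x A ->
  proj1_sig P = cext (proj1_sig D) y (ty_sub A (proj1_sig g)) ->
  proj1_sig u = sub_id (proj1_sig D) ->
  proj1_sig d = sub_id (proj1_sig G) ->
  proj1_sig q = sext (proj1_sig g) x (Var y) ->
  is_pullback u q g d.
Proof.
  destruct D as [D HD], G as [G HG], P as [P HP], E as [E HE].
  destruct g as [g Hg], u as [u Hu], q as [q Hq], d as [d Hd]; simpl in *.
  intros -> -> -> -> ->.
  assert (Hx : ~ In x (dom G)) by now inversion HE.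
  assert (Hy : ~ In y (dom D)) by now inversion HP.
  assert (HA : wf_ty G A) by now inversion HE.
  split; simpl.
  - now rewrite sub_comp_idr, sub_comp_wk, (sub_comp_idl Hg).
  - intros [X HX] [h Hh] [k Hk]; simpl in *.
    inversion Hk as [|? k' t ? ? ? Hk' _ Ht]; subst.
    rewrite sub_comp_wk, (sub_comp_idl Hk') by assumption; intros <-.
    rewrite <- ty_sub_sub in Ht
      by (rewrite (wf_sub_dom Hg); now apply wf_ty_scoped).
    exists (exist _ (sext h y t) (wf_sext Hh HP Ht)); simpl.
    rewrite sub_comp_wk, (sub_comp_idl Hh), Nat.eqb_refl by assumption.
    rewrite sub_comp_sext by (intros H; now apply Hy, (wf_sub_scoped Hg)).
    repeat split.
    intros [m Hm]; simpl; inversion Hm as [|? m' s ? ? ? Hm' _ Hs]; subst.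
    rewrite sub_comp_wk, (sub_comp_idl Hm') by assumption; intros ->; simpl.
    rewrite Nat.eqb_refl; congruence.
Qed.

(** [disp] always adds the name chosen by [fresh], whereas contexts met by induction or as images of
    [ReducedSuspension] may end with other names; hence this larger class of maps. *)
Definition is_wk (E G : Syn_CaTT) (d : Hom E G) : Prop :=
  exists x A, proj1_sig E = cext (proj1_sig G) x A /\ proj1_sig d = sub_id (proj1_sig G).

Lemma pullback_of_wk (D G E : Syn_CaTT) (d : Hom E G) (g : Hom D G) (x : nat) (A : ty) :
  proj1_sig E = cext (proj1_sig G) x A -> proj1_sig d = sub_id (proj1_sig G) ->
  exists (B : Ty D) (q : Hom (ext B) E),
    proj1_sig B = ty_sub A (proj1_sig g) /\
    proj1_sig q = sext (proj1_sig g) x (Var (fresh (dom (proj1_sig D)))) /\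
    is_pullback (disp B) q g d.
Proof.
  destruct D as [D HD], G as [G HG], E as [E HE], g as [g Hg], d as [d Hd]; simpl in *.
  intros -> ->.
  assert (HA : wf_ty G A) by now inversion HE.
  assert (HB : wf_ty D (ty_sub A g)) by now apply wf_subst with G.
  pose (B := exist _ (ty_sub A g) HB : Ty (obj HD)).
  exists B, (mor (D := ext B) (G := exist _ _ HE)
    (wf_sub_lift (y := fresh (dom D)) Hg HE (wf_ext_fresh HB))).
  repeat split; eapply pullback_lift; reflexivity.
Qed.

(** Pulling [d] back along the identity writes it as a canonical display map composed with an
    isomorphism that renames the last variable. *)
Lemma model_preserves_wk (F : Functor Syn_CaTT SET) (E G : Syn_CaTT) (d : Hom E G) :
  is_model F -> is_wk d -> preserves_pullbacks_along F d.
Proof.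
  intros [_ HF] (x & A & HE & Hd).
  destruct (pullback_of_wk (idm G) HE Hd) as (B & q & _ & _ & HP).
  assert (Hq : is_iso q).
  { apply (is_iso_pullback (pullback_sym HP)).
    exists (idm G); split; apply comp_idl. }
  pose proof Hq as [q' [Q1 Q2]].
  apply preserves_comp_iso with (d := disp B) (e := q').
  - rewrite <- (comp_idl (disp B)), (proj1 HP), <- comp_assoc, Q2.
    now rewrite comp_idr.
  - now exists q.
  - intros P D g u p; apply HF.
Qed.

Lemma wf_cext_inv G x A : wf_ctx (cext G x A) -> wf_ctx G.
Proof. now inversion 1. Qed.

Definition wk G x A (H : wf_ctx (cext G x A)) : Hom (obj H) (obj (wf_cext_inv H)) :=
  mor (D := obj H) (G := obj (wf_cext_inv H)) (wf_sub_wk H).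

Lemma wk_is_wk G x A (H : wf_ctx (cext G x A)) : is_wk (wk H).
Proof. now exists x, A. Qed.

Lemma terminal_cnil (G : Syn_CaTT) : proj1_sig G = cnil -> is_terminal G.
Proof.
  destruct G as [G HG]; simpl; intros -> [X HX].
  exists (mor (D := obj HX) (G := obj HG) (wf_snil HX)); intros [g Hg]; simpl.
  now inversion Hg.
Qed.

(** Objects over the same raw context may carry different typing derivations; this isomorphism
    stands in for their equality. *)
Lemma is_iso_sub_id (D G : Syn_CaTT) (i : Hom D G) :
  proj1_sig D = proj1_sig G -> proj1_sig i = sub_id (proj1_sig D) -> is_iso i.
Proof.
  destruct D as [D HD], G as [G HG], i as [i Hi]; simpl; intros <- ->.
  exists (mor (D := obj HG) (G := obj HD) Hi); simpl.
  now rewrite sub_comp_idr.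
Qed.

(** * Inverting [collapse] in models with a singleton value at [D0] *)

Section SingletonModel.
Variable F : Functor Syn_CaTT SET.
Hypothesis F_model : is_model F.
Hypothesis F_D0 : is_singleton (F D0).

Lemma terminal_D0 (G : Syn_CaTT) x :
  proj1_sig G = cext cnil x Star -> is_terminal (F G).
Proof.
  destruct G as [G HG]; simpl; intros ->.
  assert (H : wf_sub (cext cnil 0 Star) (sext snil x (Var 0)) (cext cnil x Star)).
  { constructor; auto using D0_wf; constructor; simpl; auto using D0_wf. }
  assert (K : wf_sub (cext cnil x Star) (sext snil 0 (Var x)) (cext cnil 0 Star)).
  { constructor; auto using D0_wf; constructor; simpl; auto using D0_wf. }
  apply terminal_iso with (a := F D0) (f := fmap F (mor (D := D0) (G := obj HG) H)).
  - apply is_iso_fmap; exists (mor (D := obj HG) (G := D0) K).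
    simpl; now rewrite !Nat.eqb_refl.
  - now apply is_singleton_terminal.
Qed.

(** The extended context is the product of [G] and [D0], a pullback over the empty context. [F]
    preserves this square and sends both [D0] and the empty context to terminal sets, so the map
    opposite to the weakening becomes invertible. *)
Lemma is_iso_wk_Star G x (H : wf_ctx (cext G x Star)) : is_iso (fmap F (wk H)).
Proof.
  set (HG := wf_cext_inv H).
  assert (Hq : wf_sub (cext G x Star) (sext snil 0 (Var x)) (cext cnil 0 Star)).
  { constructor; auto using D0_wf; constructor; simpl; auto. }
  assert (Hd : wf_sub (cext cnil 0 Star) snil cnil) by auto using wf_snil, D0_wf.
  assert (HP : is_pullback (wk H) (mor (D := obj H) (G := D0) Hq)
    (mor (D := obj HG) (G := nil_obj) (wf_snil HG)) (mor (D := D0) (G := nil_obj) Hd)).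
  { eapply pullback_lift; reflexivity. }
  apply (model_preserves_wk F_model) in HP; [|now exists 0, Star].
  apply (is_iso_pullback HP), is_iso_terminal.
  - now apply terminal_D0 with 0.
  - apply F_model.
Qed.

Definition collapse_map G (HG : wf_ctx G) :
  Hom (ReducedSuspension (Desuspension (obj HG))) (obj HG) :=
  mor (D := ReducedSuspension (Desuspension (obj HG))) (G := obj HG) (wf_collapse HG).

Lemma S_D_type G A : wf_ty G A -> S_ty (D_ctx G) (D_ty A) = ty_sub A (collapse G).
Proof. apply S_D. Qed.

Lemma is_iso_collapse G (HG : wf_ctx G) : is_iso (fmap F (collapse_map HG)).
Proof.
  induction G as [|G IH x A].
  (* The source is not empty: it consists of [bullet] alone, and its value is terminal by the
     hypothesis on [D0]. *)
  - apply is_iso_terminal; [now apply terminal_D0 with bullet|].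
    apply fmap_terminal with nil_obj;
      [apply nil_terminal|now apply terminal_cnil|apply F_model].
  - specialize (IH (wf_cext_inv HG)).
    set (c := collapse_map (wf_cext_inv HG)) in *.
    assert (HA : wf_ty G A) by now inversion HG.
    assert (E : forall t, sub_comp (sub_id G) (sext (collapse G) x t) = collapse G).
    { intros t; rewrite sub_comp_wk by now inversion HG.
      exact (sub_comp_idl (wf_collapse (wf_cext_inv HG))). }
    destruct A as [|A t u].
    (* The new variable disappears from the source, so [i] is an identity up to typing derivations,
       and the new component followed by the weakening is [c ∘ i]. *)
    + apply (is_iso_cancel (is_iso_wk_Star HG)).
      pose (i := mor (D := ReducedSuspension (Desuspension (obj HG)))
        (G := ReducedSuspension (Desuspension (obj (wf_cext_inv HG))))
        (wf_sub_id (S_wf_ctx (D_wf_ctx (wf_cext_inv HG))))).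
      apply is_iso_ext with (fmap F c ∘ fmap F i).
      * rewrite <- !fmap_comp; apply fmap_ext; simpl.
        now rewrite E, sub_comp_idr.
      * apply is_iso_comp; auto; now apply is_iso_fmap, is_iso_sub_id.
    + pose (u0 := mor (D := ReducedSuspension (Desuspension (obj HG)))
        (G := ReducedSuspension (Desuspension (obj (wf_cext_inv HG))))
        (wf_sub_wk (S_wf_ctx (D_wf_ctx HG)))).
      (* The new variable of the source has the type of [x] acted on by [collapse G], so the new
         component is the pullback of [c] along the weakening. *)
      assert (HP : is_pullback u0 (collapse_map HG) c (wk HG)).
      { eapply pullback_lift; try reflexivity; simpl.
        f_equal; exact (S_D_type HA). }
      apply (model_preserves_wk F_model (wk_is_wk HG)) in HP.
      exact (is_iso_pullback (pullback_sym HP) IH).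
Qed.

End SingletonModel.

(** * Weakenings and their pullbacks in MCaTT *)

Definition mobj G (HG : mwf_ctx G) : Syn_MCaTT := exist _ G HG.

Definition mmor (D G : Syn_MCaTT) (g : msub)
  (H : mwf_sub (proj1_sig D) g (proj1_sig G)) : Hom D G := exist _ g H.

Lemma mwf_sub_lift D g G x y A B :
  mwf_sub D g G -> mwf_ctx (mcext G x A) -> mwf_ctx (mcext D y B) ->
  meq_ty D B (mty_sub A g) -> mwf_sub (mcext D y B) (msext g x (MVar y)) (mcext G x A).
Proof.
  intros Hg HG HD E; constructor; auto.
  - eapply mwf_weaken; eauto using sub_mctx_cext.
  - apply mwf_conv with B; [constructor; simpl; auto|].
    eapply mwf_weaken; eauto using sub_mctx_cext.
Qed.

(** [B] is compared with [mty_sub A g] only up to definitional equality, since in the use with the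
    counit the two types agree through the η-rule. Last terms of substitutions are retyped by
    conversion. *)
Lemma mpullback_lift (D G P E : Syn_MCaTT) (x y : nat) (A B : mty)
    (g : Hom D G) (u : Hom P D) (q : Hom P E) (d : Hom E G) :
  proj1_sig E = mcext (proj1_sig G) x A ->
  proj1_sig P = mcext (proj1_sig D) y B ->
  meq_ty (proj1_sig D) B (mty_sub A (proj1_sig g)) ->
  proj1_sig u = msub_id (proj1_sig D) ->
  proj1_sig d = msub_id (proj1_sig G) ->
  proj1_sig q = msext (proj1_sig g) x (MVar y) ->
  is_pullback u q g d.
Proof.
  destruct D as [D HD], G as [G HG], P as [P HP], E as [E HE].
  destruct g as [g Hg], u as [u Hu], q as [q Hq], d as [d Hd]; simpl in *.
  intros -> -> HB -> -> ->.
  assert (Hx : ~ In x (mdom G)) by now inversion HE.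
  assert (Hy : ~ In y (mdom D)) by now inversion HP.
  assert (HA : mwf_ty G A) by now inversion HE.
  split; simpl.
  - rewrite msub_comp_idr, msub_comp_wk, (msub_comp_idl Hg) by assumption.
    apply meq_sub_refl; now inversion Hq.
  - intros [X HX] [h Hh] [k Hk]; simpl in *.
    inversion Hk as [|? k' t ? ? ? Hk' _ Ht]; subst.
    rewrite msub_comp_wk, (msub_comp_idl Hk') by assumption; intros E.
    assert (Hgh : mwf_sub X (msub_comp g h) G) by now apply mwf_sub_comp with D.
    (* The cone commutes only up to [meq_sub], so functoriality of [A] in equal substitutions is
       what types the last term of [k] over [h]. *)
    assert (EA : meq_ty X (mty_sub A k') (mty_sub B h)).
    { apply meq_ty_trans with (mty_sub A (msub_comp g h)).
      - apply meq_ty_sym; eapply meq_ty_functional; eauto.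
      - rewrite <- mty_sub_sub
          by (rewrite (mwf_sub_dom Hg); now apply mwf_ty_scoped).
        apply meq_ty_sym; eapply mwf_subst; eauto. }
    pose proof (mwf_conv Ht EA) as Ht'.
    exists (mmor (D := mobj HX) (G := mobj HP) (mwf_sext Hh HP Ht')); simpl.
    rewrite msub_comp_wk, (msub_comp_idl Hh), Nat.eqb_refl by assumption.
    rewrite msub_comp_sext by (intros H; now apply Hy, (mwf_sub_scoped Hg)).
    split; [split|].
    + now apply meq_sub_refl.
    + constructor; auto; apply meq_tm_refl, mwf_conv with (mty_sub A k'); auto.
      apply meq_ty_sym; eapply meq_ty_functional; eauto.
    + intros [m Hm]; simpl; inversion Hm as [|? m' s ? ? ? Hm' _ Hs]; subst.
      rewrite msub_comp_wk, (msub_comp_idl Hm') by assumption; intros E1 E2.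
      simpl in E2; rewrite Nat.eqb_refl in E2.
      rewrite msub_comp_sext in E2 by (intros H; now apply Hy, (mwf_sub_scoped Hg)).
      inversion E2; subst; constructor; auto.
      eapply meq_conv; eauto.
      rewrite <- mty_sub_sub
        by (rewrite (mwf_sub_dom Hg); now apply mwf_ty_scoped).
      apply meq_ty_sym; eapply mwf_subst; eauto.
Qed.

Definition is_mwk (E G : Syn_MCaTT) (d : Hom E G) : Prop :=
  exists x A, proj1_sig E = mcext (proj1_sig G) x A /\ proj1_sig d = msub_id (proj1_sig G).

Lemma pullback_of_mwk (D G E : Syn_MCaTT) (d : Hom E G) (g : Hom D G) (x : nat) (A : mty) :
  proj1_sig E = mcext (proj1_sig G) x A -> proj1_sig d = msub_id (proj1_sig G) ->
  exists (B : Ty D) (q : Hom (ext B) E),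
    proj1_sig B = mty_sub A (proj1_sig g) /\
    proj1_sig q = msext (proj1_sig g) x (MVar (fresh (mdom (proj1_sig D)))) /\
    is_pullback (disp B) q g d.
Proof.
  destruct D as [D HD], G as [G HG], E as [E HE], g as [g Hg], d as [d Hd]; simpl in *.
  intros -> ->.
  assert (HA : mwf_ty G A) by now inversion HE.
  assert (HB : mwf_ty D (mty_sub A g)) by now apply mwf_subst with G.
  pose (B := exist _ (mty_sub A g) HB : Ty (mobj HD)).
  exists B, (mmor (D := ext B) (G := exist _ _ HE)
    (mwf_sub_lift (y := fresh (mdom D)) Hg HE (mwf_ext_fresh HB) (meq_ty_refl HB))).
  repeat split; eapply mpullback_lift; try reflexivity; now apply meq_ty_refl.
Qed.

Lemma model_preserves_mwk (F : Functor Syn_MCaTT SET) (E G : Syn_MCaTT) (d : Hom E G) :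
  is_model F -> is_mwk d -> preserves_pullbacks_along F d.
Proof.
  intros [_ HF] (x & A & HE & Hd).
  destruct (pullback_of_mwk (idm G) HE Hd) as (B & q & _ & _ & HP).
  assert (Hq : is_iso q).
  { apply (is_iso_pullback (pullback_sym HP)).
    exists (idm G); split; apply comp_idl. }
  pose proof Hq as [q' [Q1 Q2]].
  apply preserves_comp_iso with (d := disp B) (e := q').
  - rewrite <- (comp_idl (disp B)), (proj1 HP), <- comp_assoc, Q2.
    now rewrite comp_idr.
  - now exists q.
  - intros P D g u p; apply HF.
Qed.

Lemma mwf_cext_inv G x A : mwf_ctx (mcext G x A) -> mwf_ctx G.
Proof. now inversion 1. Qed.

Definition mwk G x A (H : mwf_ctx (mcext G x A)) : Hom (mobj H) (mobj (mwf_cext_inv H)) :=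
  mmor (D := mobj H) (G := mobj (mwf_cext_inv H)) (mwf_sub_wk H).

Lemma mwk_is_mwk G x A (H : mwf_ctx (mcext G x A)) : is_mwk (mwk H).
Proof. now exists x, A. Qed.

Lemma terminal_mcnil (G : Syn_MCaTT) : proj1_sig G = mcnil -> is_terminal G.
Proof.
  destruct G as [G HG]; simpl; intros -> [X HX].
  exists (mmor (D := mobj HX) (G := mobj HG) (mwf_snil HX)); intros [g Hg]; simpl.
  inversion Hg; now constructor.
Qed.

Lemma is_iso_msub_id (D G : Syn_MCaTT) (i : Hom D G) :
  proj1_sig D = proj1_sig G -> proj1_sig i = msub_id (proj1_sig D) -> is_iso i.
Proof.
  destruct D as [D HD], G as [G HG], i as [i Hi]; simpl; intros <- ->.
  exists (mmor (D := mobj HG) (G := mobj HD) Hi); simpl.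
  rewrite msub_comp_idr; split; now apply meq_sub_refl.
Qed.

(** * The unit type and the counit *)

(** By η the last variable equals (), so extending by () inverts the weakening already in the
    syntax. *)
Lemma is_iso_mwk_One G x (H : mwf_ctx (mcext G x MOne)) : is_iso (mwk H).
Proof.
  set (HG := mwf_cext_inv H).
  pose (s := mmor (D := mobj HG) (G := mobj H)
    (mwf_sext (mwf_sub_id HG) H (mwf_Tt HG))).
  assert (Hx : ~ In x (mdom G)) by now inversion H.
  exists s; simpl; rewrite msub_comp_wk, !msub_comp_idr by assumption; split.
  - constructor; auto.
    + apply meq_sub_refl, (mwf_sub_wk H).
    + apply meq_tm_sym, meq_eta; constructor; simpl; auto.
  - now apply meq_sub_refl, mwf_sub_id.
Qed.

(** This covers the desuspensions of [D0] and of the context made of [bullet] alone, the latter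
    being the reduced suspension of the empty context. *)
Lemma terminal_mcext_One (G : Syn_MCaTT) x :
  proj1_sig G = mcext mcnil x MOne -> is_terminal G.
Proof.
  destruct G as [G HG]; simpl; intros ->.
  destruct (is_iso_mwk_One HG) as [s Hs].
  apply (terminal_iso (a := mobj (mwf_cext_inv HG)) (f := s)).
  - now exists (mwk HG).
  - now apply terminal_mcnil.
Qed.

(** The substitution D Σ_r G → G; the variables of type [MOne], which Σ_r drops,
    are sent to (). *)
Fixpoint counit (G : mctx) : msub :=
  match G with
  | mcnil => msnil
  | mcext G x A => msext (counit G) x (if is_one A then MTt else MVar (S x))
  end.

Lemma mlookup_counit G x A : mwf_ctx G -> in_mctx x A G ->
  mlookup (counit G) x = if is_one A then MTt else MVar (S x).
Proof.
  intros HG; revert x A; induction HG as [|G y B HG IH HB Hy]; simpl; [easy|].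
  intros x A [[-> ->]|Hx]; [now rewrite Nat.eqb_refl|].
  destruct (Nat.eqb_spec x y); subst; auto.
  now apply in_mctx_dom in Hx.
Qed.

Lemma DS_wf_ctx G : mwf_ctx G -> mwf_ctx (D_ctx (S_ctx G)).
Proof. intros; now apply D_wf_ctx, S_wf_ctx. Qed.

(** At a variable of type [Star], [collapse] gives [bullet] and [counit] gives (); after
    desuspension both have type [MOne] and η identifies them. Elsewhere they coincide. *)
Lemma D_collapse G : wf_ctx G ->
  meq_sub (D_ctx (S_ctx (D_ctx G))) (D_sub (collapse G)) (counit (D_ctx G)) (D_ctx G).
Proof.
  induction 1 as [|G x A HG IH HA Hx]; [repeat constructor; auto|].
  assert (HGA : wf_ctx (cext G x A)) by now constructor.
  pose proof (D_wf_sub (wf_collapse HGA)) as Hc.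
  pose proof (D_wf_ctx HGA) as HDGA.
  destruct A as [|A t u]; simpl in *; inversion Hc; subst; constructor; auto.
  - now apply meq_eta.
  - eapply mwf_weaken; eauto using sub_mctx_cext, mwf_sub_ctx.
  - now apply meq_tm_refl.
Qed.

Lemma counit_vars G y :
  In y (msub_vars (counit G)) -> exists z, y = S z /\ In z (mdom G).
Proof.
  induction G as [|G IH x A]; simpl; [easy|].
  rewrite in_app_iff; intros [H|H].
  - destruct (IH H) as (z & -> & Hz); eauto.
  - destruct (is_one A); simpl in H; [easy|]; destruct H as [<-|[]]; eauto.
Qed.

(** Typing and naturality are proved together: typing the counit on an extended context requires
    comparing [D_ty (S_ty G A)] with [mty_sub A (counit G)], which in turn involves the terms and
    substitutions occurring in [A]. *)
Lemma counit_spec :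
  (forall G, mwf_ctx G -> mwf_sub (D_ctx (S_ctx G)) (counit G) G) /\
  (forall G A, mwf_ty G A ->
     mwf_sub (D_ctx (S_ctx G)) (counit G) G /\
     meq_ty (D_ctx (S_ctx G)) (D_ty (S_ty G A)) (mty_sub A (counit G))) /\
  (forall G t A, mwf_tm G t A ->
     mwf_sub (D_ctx (S_ctx G)) (counit G) G /\
     meq_tm (D_ctx (S_ctx G)) (D_tm (S_tm G t)) (mtm_sub t (counit G))
       (mty_sub A (counit G))) /\
  (forall D g G, mwf_sub D g G ->
     mwf_sub (D_ctx (S_ctx D)) (counit D) D /\
     mwf_sub (D_ctx (S_ctx G)) (counit G) G /\
     meq_sub (D_ctx (S_ctx D)) (msub_comp (counit G) (D_sub (S_sub D g G)))
       (msub_comp g (counit D)) G) /\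
  (forall G A B, meq_ty G A B -> True) /\
  (forall G t u A, meq_tm G t u A -> True) /\
  (forall D g h G, meq_sub D g h G -> True).
Proof.
  apply mwf_mind; auto.
  - repeat constructor; auto.
  - intros G x A HG IHG HA [_ IHA] Hx.
    assert (HGA : mwf_ctx (mcext G x A)) by now constructor.
    pose proof (DS_wf_ctx HGA) as HD.
    destruct A as [|A t u]; simpl in *.
    + constructor; auto; constructor; auto.
    + apply mwf_sub_lift; auto.
  - intros G HG IHG; split; auto; simpl.
    apply meq_ty_refl; constructor; now apply DS_wf_ctx.
  - intros G A t u _ [HG IHA] _ [_ IHt] _ [_ IHu]; split; auto; simpl.
    apply meq_ty_sym in IHA.
    apply meq_Arr; [now apply meq_ty_sym| |]; eapply meq_conv; eauto.
  - intros G x A HG IHG Hx; split; auto; simpl.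
    pose proof (mwf_lookup IHG Hx) as H; revert H.
    rewrite (mlookup_counit HG Hx), (has_type_one_in HG Hx).
    destruct A as [|A t u]; simpl; intros H; [|now apply meq_tm_refl].
    apply meq_eta; constructor; [now apply DS_wf_ctx|].
    apply (D_in_ctx (A := Star)), S_ctx_bullet.
  - intros G HG IHG; split; auto; simpl.
    apply meq_eta; constructor; [now apply DS_wf_ctx|].
    apply (D_in_ctx (A := Star)), S_ctx_bullet.
  (* The translated constructor carries [collapse Th]; by [D_collapse] its desuspension equals the
     counit of [D_ctx Th], and naturality at [g] concludes. *)
  - intros D k Th A g HTh HA Hg (HD & HG & IHg); split; auto; simpl.
    assert (Hgc : mwf_sub (D_ctx (S_ctx D)) (msub_comp g (counit D)) (D_ctx Th))
      by now apply mwf_sub_comp with D.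
    pose proof (D_wf_sub (S_wf_sub Hg)) as HSg.
    pose proof (wf_collapse (ps_wf HTh)) as Hc.
    rewrite mty_sub_sub
      by (rewrite (mwf_sub_dom Hg); now apply D_valid_scoped with k).
    rewrite (proj2 (D_subst _)).
    (* [meq_Con] types an equation by its left substitution, hence the reversal. *)
    apply meq_tm_sym, meq_Con; auto.
    apply meq_sub_sym; [eapply mwf_sub_comp; eauto using D_wf_sub|].
    eapply meq_sub_trans; [eapply mwf_sub_comp; eauto using D_wf_sub| |exact IHg].
    eapply mwf_subst; eauto using D_collapse, ps_wf.
  - intros G t A B Ht [HG IHt] HAB _; split; auto.
    eapply meq_conv; eauto; eapply mwf_subst; eauto.
  - intros D HD IHD; repeat split; simpl; auto; repeat constructor; auto.
    now apply DS_wf_ctx.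
  - intros D g t G x A Hg (HD & HG & IHg) HGA IHGA Ht [_ IHt]; repeat split; auto.
    inversion HGA; subst.
    pose proof (D_wf_sub (S_wf_sub Hg)) as HSg.
    destruct (is_one A) eqn:EA; simpl; rewrite EA; simpl.
    (* [S_sub] omits this component and the counit restores it as (), equal by η to any term of type
       [MOne]. *)
    + apply is_one_spec in EA; subst; constructor; auto.
      apply meq_tm_sym, meq_eta.
      exact (proj1 (proj2 (proj2 mwf_subst)) _ _ _ Ht _ _ HD).
    + rewrite Nat.eqb_refl, msub_comp_sext.
      * constructor; auto; eapply meq_conv; [exact IHt|].
        rewrite mty_sub_sub by (rewrite (mwf_sub_dom Hg); now apply mwf_ty_scoped).
        apply meq_ty_sym; eapply meq_ty_functional; eauto.
        eapply mwf_sub_comp; eauto.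
      * intros Hx; destruct (counit_vars Hx) as (z & Ez & Hz).
        injection Ez as <-; auto.
Qed.

Lemma mwf_counit G : mwf_ctx G -> mwf_sub (D_ctx (S_ctx G)) (counit G) G.
Proof. apply counit_spec. Qed.

Definition counit_map G (HG : mwf_ctx G) :
  Hom (Desuspension (ReducedSuspension (mobj HG))) (mobj HG) :=
  mmor (D := Desuspension (ReducedSuspension (mobj HG))) (G := mobj HG) (mwf_counit HG).

(** η settles the base case and the case of [MOne] in the syntax; the model enters at arrow types,
    where the new component is the pullback of [c] along the weakening. *)
Lemma is_iso_counit (F : Functor Syn_MCaTT SET) G (HG : mwf_ctx G) :
  is_model F -> is_iso (fmap F (counit_map HG)).
Proof.
  intros HF; induction G as [|G IH x A].
  - apply is_iso_fmap, is_iso_terminal.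
    + now apply terminal_mcext_One with bullet.
    + now apply terminal_mcnil.
  - specialize (IH (mwf_cext_inv HG)).
    set (c := counit_map (mwf_cext_inv HG)) in *.
    pose proof (mwf_counit (mwf_cext_inv HG)) as Hc.
    assert (HA : mwf_ty G A) by now inversion HG.
    assert (E : forall t, msub_comp (msub_id G) (msext (counit G) x t) = counit G).
    { intros t; rewrite msub_comp_wk by now inversion HG.
      exact (msub_comp_idl Hc). }
    destruct A as [|A t u].
    + apply (is_iso_cancel (is_iso_fmap F (is_iso_mwk_One HG))).
      pose (i := mmor (D := Desuspension (ReducedSuspension (mobj HG)))
        (G := Desuspension (ReducedSuspension (mobj (mwf_cext_inv HG))))
        (mwf_sub_id (DS_wf_ctx (mwf_cext_inv HG)))).
      apply is_iso_ext with (fmap F c ∘ fmap F i).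
      * rewrite <- !fmap_comp; apply fmap_ext; simpl.
        rewrite E, msub_comp_idr; now apply meq_sub_refl.
      * apply is_iso_comp; auto; now apply is_iso_fmap, is_iso_msub_id.
    + pose (u0 := mmor (D := Desuspension (ReducedSuspension (mobj HG)))
        (G := Desuspension (ReducedSuspension (mobj (mwf_cext_inv HG))))
        (mwf_sub_wk (DS_wf_ctx HG))).
      assert (HP : is_pullback u0 (counit_map HG) c (mwk HG)).
      { eapply mpullback_lift; try reflexivity.
        now apply counit_spec. }
      apply (model_preserves_mwk HF (mwk_is_mwk HG)) in HP.
      exact (is_iso_pullback (pullback_sym HP) IH).
Qed.

(** * Display maps under desuspension and reduced suspension *)

(** Desuspension commutes with substitution, so the canonical pullback of a display map goes to a
    square as in [mpullback_lift]. *)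
Lemma Desuspension_preserves (G : Syn_CaTT) (A : Ty G) :
  preserves_pullbacks_along Desuspension (disp A).
Proof.
  apply preserves_chosen; intros D g.
  destruct (pullback_of_wk g (d := disp A) eq_refl eq_refl) as (B & q & HB & Hq & HP).
  exists (ext B), (disp B), q; split; auto.
  apply mpullback_lift with (x := fresh (dom (proj1_sig G)))
    (y := fresh (dom (proj1_sig D))) (A := D_ty (proj1_sig A)) (B := D_ty (proj1_sig B));
    simpl; auto using D_sub_id.
  - rewrite HB, D_ty_sub; apply meq_ty_refl; rewrite <- D_ty_sub, <- HB.
    apply D_wf, (proj2_sig B).
  - exact (f_equal D_sub Hq).
Qed.

Lemma Desuspension_disp_is_mwk (G : Syn_CaTT) (A : Ty G) :
  is_mwk (fmap Desuspension (disp A)).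
Proof.
  exists (fresh (dom (proj1_sig G))), (D_ty (proj1_sig A)); simpl.
  now rewrite D_sub_id.
Qed.

Lemma S_sub_wk G x A : mwf_ctx (mcext G x A) ->
  S_sub (mcext G x A) (msub_id G) G = sub_id (S_ctx G).
Proof.
  intros H; inversion H as [|? ? ? HG HA Hx]; subst.
  rewrite S_sub_cext; [now apply S_sub_id|].
  intros Hx'; apply Hx; revert Hx'; apply mwf_sub_scoped with G; now apply mwf_sub_id.
Qed.

(** A variable of type [MOne] is dropped, leaving an identity up to typing derivations. Any other
    variable gets a shifted name, which need not be the one chosen by [ext]; hence [is_wk]. *)
Lemma ReducedSuspension_disp (G : Syn_MCaTT) (A : Ty G) :
  is_iso (fmap ReducedSuspension (disp A)) \/ is_wk (fmap ReducedSuspension (disp A)).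
Proof.
  destruct G as [G HG], A as [A HA]; simpl in HA.
  destruct A as [|A t u]; [left|right].
  - apply is_iso_sub_id; simpl; auto.
    apply S_sub_wk; now apply mwf_ext_fresh.
  - exists (S (fresh (mdom G))), (S_ty G (MArr A t u)); split; auto.
    apply S_sub_wk; now apply mwf_ext_fresh.
Qed.

Lemma ReducedSuspension_preserves (G : Syn_MCaTT) (A : Ty G) :
  preserves_pullbacks_along ReducedSuspension (disp A).
Proof.
  apply preserves_chosen; intros D g.
  destruct (pullback_of_mwk g (d := disp A) eq_refl eq_refl) as (B & q & HB & Hq & HP).
  exists (ext B), (disp B), q; split; auto.
  assert (E : fmap ReducedSuspension g ∘ fmap ReducedSuspension (disp B) ≈
      fmap ReducedSuspension (disp A) ∘ fmap ReducedSuspension q)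
    by (rewrite <- !fmap_comp; apply fmap_ext, HP).
  destruct G as [G HG], A as [A HA], D as [D HD], B as [B HB'], g as [g Hg], q as [q Hq'].
  simpl in HA, HB', HB, Hq, Hg; subst B q.
  destruct A as [|A t u].
  (* Substitution fixes [MOne], so the images of [disp A] and [disp B] are both isomorphisms. *)
  - apply pullback_iso; auto; apply is_iso_sub_id; simpl; auto;
      apply S_sub_wk; now apply mwf_ext_fresh.
  - apply pullback_lift with (x := S (fresh (mdom G))) (y := S (fresh (mdom D)))
      (A := S_ty G (MArr A t u)); auto.
    + cbn [proj1_sig fob ReducedSuspension ext Syn_MCaTT S_ctx is_one mty_sub].
      f_equal; exact (proj1 (proj2 S_subst) _ _ HA _ _ Hg).
    + apply S_sub_wk; now apply mwf_ext_fresh.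
    + apply S_sub_wk; now apply mwf_ext_fresh.
    + simpl; rewrite Nat.eqb_refl.
      rewrite S_sub_cext; auto.
      intros Hx; apply (fresh_spec (l := mdom D)), (mwf_sub_scoped Hg), Hx.
Qed.

(** * Precomposition yields models *)

Lemma precomp_D_model (M : Mod Syn_MCaTT) : is_model (precomp_D M).
Proof.
  destruct M as [M HM]; split.
  - apply fmap_terminal with (F := M) (t := mnil_obj);
      [apply mnil_terminal|now apply terminal_mcnil|apply HM].
  - intros G D P A g.
    apply (preserves_FunComp (F := Desuspension) (G := M)).
    + apply Desuspension_preserves.
    + apply model_preserves_mwk; auto using Desuspension_disp_is_mwk.
Qed.

(** Desuspension turns [D0] into a single variable of type [MOne], a terminal context by η. *)
Lemma precomp_D_singleton (M : Mod Syn_MCaTT) :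
  is_singleton (fob (precomp_D M : Functor Syn_CaTT SET) D0).
Proof.
  destruct M as [M HM]; apply is_singleton_terminal.
  apply fmap_terminal with (F := M) (t := mnil_obj);
    [apply mnil_terminal|now apply terminal_mcext_One with 0|apply HM].
Qed.

Lemma precomp_S_model (F : Mod_CaTT_D0) : is_model (precomp_S F).
Proof.
  destruct F as [[F HF] HF0]; split.
  (* The empty context is sent to a copy of [D0], so the singleton condition is what preserves the
     terminal object. *)
  - now apply (terminal_D0 HF0) with bullet.
  - intros G D P A g.
    apply (preserves_FunComp (F := ReducedSuspension) (G := F)).
    + apply ReducedSuspension_preserves.
    + destruct (ReducedSuspension_disp A).
      * now apply preserves_iso.
      * now apply model_preserves_wk.
Qed.

(** * The comparison transformations and the equivalence *)

Definition collapse_nt :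
  NatTrans (FunComp ReducedSuspension Desuspension) (FunId Syn_CaTT).
Proof.
  refine (@Build_NatTrans Syn_CaTT Syn_CaTT (FunComp ReducedSuspension Desuspension)
    (FunId Syn_CaTT)
    (fun G => mor (D := ReducedSuspension (Desuspension G)) (G := G)
       (wf_collapse (proj2_sig G))) _).
  intros [D HD] [G HG] [g Hg]; now apply S_D.
Defined.

Definition counit_nt :
  NatTrans (FunComp Desuspension ReducedSuspension) (FunId Syn_MCaTT).
Proof.
  refine (@Build_NatTrans Syn_MCaTT Syn_MCaTT (FunComp Desuspension ReducedSuspension)
    (FunId Syn_MCaTT)
    (fun G => mmor (D := Desuspension (ReducedSuspension G)) (G := G)
       (mwf_counit (proj2_sig G))) _).
  intros [D HD] [G HG] [g Hg]; now apply counit_spec.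
Defined.

(** Up to the associativity and unit laws of functor composition, this is the
    whiskering of [r] by [F]. *)
Definition whisker (C D E : Category) (K : Functor C D) (L : Functor D C)
  (r : NatTrans (FunComp L K) (FunId C)) (F : Functor C E) :
  NatTrans (FunComp (FunComp F L) K) F.
Proof.
  refine (@Build_NatTrans C E (FunComp (FunComp F L) K) F
    (fun a => fmap F (r a : Hom (FunComp L K a) a)) _).
  intros a b f; simpl; rewrite <- !fmap_comp; apply fmap_ext, (nt_nat r).
Defined.

Theorem mainTheorem2 :
  exists (hD : forall M : Mod Syn_MCaTT, is_model (precomp_D M))
         (hD0 : forall M : Mod Syn_MCaTT,
            singleton_at_D0 (lift_full (D := FunCat Syn_CaTT SET)
                               (P := @is_model Syn_CaTT) hD M))
         (hS : forall F : Mod_CaTT_D0, is_model (precomp_S F)),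
    inverse_equivalences
      (lift_full (C := Mod Syn_MCaTT) (D := Mod Syn_CaTT) hD0
        : Functor (Mod Syn_MCaTT) Mod_CaTT_D0)
      (lift_full (C := Mod_CaTT_D0) (D := FunCat Syn_MCaTT SET)
         (P := @is_model Syn_MCaTT) hS
        : Functor Mod_CaTT_D0 (Mod Syn_MCaTT)).
Proof.
  exists precomp_D_model, precomp_D_singleton, precomp_S_model; split.
  - match goal with |- isomorphic ?F ?G =>
      unshelve epose (r := @Build_NatTrans _ _ F G (fun M => whisker counit_nt (proj1_sig M)) _)
    end.
    (* Naturality in the model is the naturality of [f] at the components of the counit. *)
    { intros M N f G x; symmetry; exact (nt_nat (f : NatTrans _ _) _ x). }
    (* Invertibility is checked model by model, and then context by context. *)
    exists r; apply nat_iso.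
    intros [M HM]; apply nat_iso; intros [G HG]; now apply is_iso_counit.
  - match goal with |- isomorphic ?F ?G =>
      unshelve epose (r := @Build_NatTrans _ _ F G
        (fun M => whisker collapse_nt (proj1_sig (proj1_sig M))) _)
    end.
    { intros M N f G x; symmetry; exact (nt_nat (f : NatTrans _ _) _ x). }
    exists r; apply nat_iso.
    intros [[F HF] HF0]; apply nat_iso; intros [G HG]; now apply is_iso_collapse.
Qed.
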